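(* Let $f\colon\mathbb{R}^n\to[-\infty,+\infty]$ be an absolutely symmetric function and let $X\in\mathbb{M}_{m,n}$ with $(f\circ\sigma)(X)$ finite. Assume that $H\in T_{\mathrm{dom}(f\circ\sigma)}(X)$ and that $f$ is locally Lipschitz continuous relative to its domain and parabolically epi-differentiable at $\sigma(X)$ for $\sigma'(X;H)$. Then for every $W\in\mathbb{M}_{m,n}$ the parabolic subderivative of $f\circ\sigma$ at $X$ for $H$ with respect to $W$ is $$\mathrm{d}^2(f\circ\sigma)(X)(H\mid W)=\mathrm{d}^2f(\sigma(X))\big(\sigma'(X;H)\mid\sigma''(X;H,W)\big),$$ and $f\circ\sigma$ is parabolically epi-differentiable at $X$ for $H$.
   Context: Throughout, $m,n$ are natural numbers with $n\le m$; $\mathbb{M}_{m,n}$ is the space of real $m\times n$ matrices with the Frobenius norm; $\sigma(X)$ is the vector of singular values of $X$ in nonincreasing order. $\sigma'(X;H)=\lim_{t\downarrow0}(\sigma(X+tH)-\sigma(X))/t$ and $\sigma''(X;H,W)=\lim_{t\downarrow0}\frac{\sigma(X+tH+\frac12t^2W)-\sigma(X)-t\sigma'(X;H)}{\frac12t^2}$ (both always exist). $f$ is absolutely symmetric if $f(Qx)=f(x)$ for all $x$ and all signed permutation matrices $Q$ (entries in $\{0,\pm1\}$, one nonzero entry in each row and column). $\mathrm{dom}\,g=\{x:g(x)<\infty\}$. $g$ is locally Lipschitz continuous relative to its domain if for every $\bar x\in\mathrm{dom}\,g$, $g(\bar x)$ is finite and there are $l\ge0$ and a neighborhood $O$ of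 $\bar x$ with $|g(x)-g(y)|\le l\|x-y\|$ for all $x,y\in O\cap\mathrm{dom}\,g$. The tangent cone is $T_C(\bar x)=\{w:\exists t_k\downarrow0,\ w_k\to w,\ \bar x+t_kw_k\in C\}$. For $g$ with $g(\bar x)$ finite, $\mathrm{d}g(\bar x)(w)=\liminf_{t\downarrow0,w'\to w}\frac{g(\bar x+tw')-g(\bar x)}{t}$; for $w$ with $\mathrm{d}g(\bar x)(w)$ finite, the parabolic subderivative is $$\mathrm{d}^2g(\bar x)(w\mid z)=\liminf_{\tau\downarrow0,\,z'\to z}\frac{g(\bar x+\tau w+\frac12\tau^2z')-g(\bar x)-\tau\,\mathrm{d}g(\bar x)(w)}{\frac12\tau^2}.$$ $g$ is parabolically epi-differentiable at $\bar x$ for $w$ if $\mathrm{dom}\,\mathrm{d}^2g(\bar x)(w\mid\cdot)\ne\emptyset$ and for every $z$ and every sequence $\tau_k\downarrow0$ there is a sequence $z_k\to z$ such that $\frac{g(\bar x+\tau_kw+\frac12\tau_k^2z_k)-g(\bar x)-\tau_k\mathrm{d}g(\bar x)(w)}{\frac12\tau_k^2}\to\mathrm{d}^2g(\bar x)(w\mid z)$. *)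

(* Defs.v *)
From HB Require Import structures.
From mathcomp Require Import all_boot all_order all_algebra.
From mathcomp Require Import all_classical all_reals all_analysis.
From mathcomp Require Import spectral complex.

Set Implicit Arguments.
Unset Strict Implicit.
Unset Printing Implicit Defensive.

Import Order.TTheory GRing.Theory Num.Theory.
Import numFieldNormedType.Exports.

Local Open Scope classical_set_scope.
Local Open Scope ring_scope.

(* Vectors of R^n are column vectors 'cV[R]_n = 'M[R]_(n, 1), so that the
   notions below for functions on matrices apply to f and to f \o sigma alike.
   Limits and neighborhoods refer to the topology of 'M[R]_(p, q) in the
   library, which is the one of the Frobenius norm; the library's norm `|A|,
   however, is the maximum norm. *)

Definition frobenius_norm (R : realType) (p q : nat) (A : 'M[R]_(p, q)) : R :=
  Num.sqrt (\sum_(i < p) \sum_(j < q) A i j ^+ 2).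

(* For n <= m: the nonnegative square roots of the eigenvalues of X^T X,
   counted with multiplicity and listed in nonincreasing order. *)
Definition is_singular_values (R : realType) (m n : nat)
    (X : 'M[R]_(m, n)) (s : 'cV[R]_n) : Prop :=
  [/\ forall i, 0 <= s i 0,
      forall i j : 'I_n, (i <= j)%N -> s j 0 <= s i 0 &
      char_poly (X^T *m X) = \prod_(i < n) ('X - (s i 0 ^+ 2)%:P)].

Definition sigma (R : realType) (m n : nat) (X : 'M[R]_(m, n)) : 'cV[R]_n :=
  xget 0 [set s | is_singular_values X s].
Arguments sigma {R m n} X.

Section SigmaWellDefined.
Local Open Scope sesquilinear_scope.
Local Open Scope complex_scope.

Lemma is_singular_values_unique (R : realType) (m n : nat) (X : 'M[R]_(m, n))
    (s t : 'cV[R]_n) :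
  is_singular_values X s -> is_singular_values X t -> s = t.
Proof.
have key (u : 'cV[R]_n) : is_singular_values X u ->
    [/\ sorted >=%R [seq u i 0 ^+ 2 | i <- enum 'I_n],
     char_poly (X^T *m X) = \prod_(x <- [seq u i 0 ^+ 2 | i <- enum 'I_n]) ('X - x%:P) &
     forall i, u i 0 = Num.sqrt (u i 0 ^+ 2)].
  move=> [u0 um uE]; split.
  - apply: (@homo_sorted _ _ (fun x => u x 0 ^+ 2) (fun i j => (i <= j)%N)).
      by move=> i j ij /=; rewrite ler_pXn2r ?nnegrE ?um.
    have := iota_sorted 0 n; rewrite -val_enum_ord sorted_map; exact.
  - by rewrite big_map big_enum.
  - by move=> i; rewrite sqrtr_sqr ger0_norm.
move=> /key[ss sE s2] /key[ts tE t2].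
have : [seq s i 0 ^+ 2 | i <- enum 'I_n] = [seq t i 0 ^+ 2 | i <- enum 'I_n].
  apply: (@sorted_eq _ >=%R) => //.
  - by move=> x y z yx zy /=; exact: le_trans zy yx.
  - by move=> x y /andP[a b]; apply/le_anti/andP; split.
  - by apply: prod_XsubC_eq; rewrite -sE -tE.
move/eq_in_map => e; apply/matrixP => i j; rewrite ord1 s2 t2 e ?mem_enum //.
Qed.

Lemma sigmaP (R : realType) (m n : nat) (X : 'M[R]_(m, n)) :
  is_singular_values X (sigma X).
Proof.
suff [s sP] : exists s, is_singular_values X s by apply: (@xgetI _ _ _ s).
pose C : numClosedFieldType := R[i].
pose io : {rmorphism R -> C} := @real_complex R.
have ioK (M : 'M[R]_(m, n)) : map_mx Num.conj (map_mx io M) = map_mx io M.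
  by apply/matrixP => i j; rewrite !mxE /=; apply/CrealP/Creal_ImP; rewrite -complexIm.
pose XC := map_mx io X.
pose A := map_mx io (X^T *m X).
have AE : A = XC^T *m XC by rewrite /A map_mxM map_trmx.
have Atr : A ^t* = A.
  by rewrite AE trmx_mul trmxK map_mxM -map_trmx ioK.
have An : A \is normalmx by apply/normalmxP; rewrite Atr.
have /= := elimT (@orthomx_spectralP _ _ A) An.
set P := spectralmx A; set d := spectral_diag A => AP.
have Pu : P \in unitmx by exact: spectral_unit.
have PU : P \is unitarymx by exact: spectral_unitarymx.
have PA : P *m A = diag_mx d *m P by rewrite [in LHS]AP !mulmxA mulmxV // mul1mx.
pose Y := P *m XC^T.
have YE : diag_mx d = Y *m Y^t*.
  rewrite /Y trmx_mul trmxK map_mxM /= ioK mulmxA -(mulmxA P) -AE PA.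
  by rewrite -mulmxA (unitarymxP PU) mulmx1.
have d_ge0 i : 0 <= d 0 i.
  have -> : d 0 i = (diag_mx d) i i by rewrite mxE eqxx mulr1n.
  rewrite YE mxE; apply: sumr_ge0 => j _; rewrite !mxE; exact: mul_conjC_ge0.
have cpA : char_poly A = \prod_(i < n) ('X - (d 0 i)%:P).
  transitivity (char_poly (diag_mx d)); last first.
    rewrite char_poly_trig ?diag_mx_is_trig //.
    by apply: eq_bigr => i _; rewrite mxE eqxx mulr1n.
  have : \det (map_mx polyC P *m char_poly_mx A) =
         \det (char_poly_mx (diag_mx d) *m map_mx polyC P).
    rewrite /char_poly_mx mulmxBr mulmxBl -!map_mxM PA.
    by rewrite scalar_mxC.
  rewrite !det_mulmx mulrC; apply: mulIf.
  by rewrite det_map_mx polyC_eq0 -unitfE -unitmxE.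
pose l := [seq Num.sqrt (complex.Re (d 0 i)) | i <- enum 'I_n].
pose s := sort (fun x y => y <= x) l.
have szs : size s = n by rewrite size_sort size_map size_enum_ord.
have ioRe i : io (complex.Re (d 0 i)) = d 0 i.
  by apply/RRe_real/ger0_real.
have Re_ge0 i : 0 <= complex.Re (d 0 i) by rewrite -(ler0c) ioRe.
have s_ge0 x : x \in s -> 0 <= x.
  by rewrite mem_sort => /mapP[i _ ->]; exact: sqrtr_ge0.
exists (\col_(i < n) s`_i); split.
- by move=> i; rewrite mxE; apply: s_ge0; rewrite mem_nth // szs.
- move=> i j ij; rewrite !mxE.
  have st : sorted (fun x y : R => y <= x) s.
    by apply: sort_sorted => x y; exact: le_total.
  by apply: (sorted_leq_nth _ _ _ st) => //;
    rewrite ?inE ?szs // => x y z; [move=> yx zy; exact: le_trans zy yx].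
- apply: (map_poly_inj io); rewrite map_char_poly cpA rmorph_prod /=.
  transitivity (\prod_(x <- s) ('X - (io (x ^+ 2))%:P)).
    rewrite (perm_big l) ?perm_sort //= big_map big_enum /=.
    by apply: eq_bigr => i _; rewrite sqr_sqrtr // ioRe.
  rewrite (big_nth 0) szs big_mkord; apply: eq_bigr => i _.
  by rewrite mxE map_polyXsubC.
Qed.

End SigmaWellDefined.

Definition sigma_d1 (R : realType) (m n : nat) (X H : 'M[R]_(m, n)) : 'cV[R]_n :=
  lim ((fun t : R => t^-1 *: (sigma (X + t *: H) - sigma X)) @ 0^'+).

Definition sigma_d2 (R : realType) (m n : nat) (X H W : 'M[R]_(m, n)) :
    'cV[R]_n :=
  lim ((fun t : R => (2^-1 * t ^+ 2)^-1 *: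
     (sigma (X + t *: H + (2^-1 * t ^+ 2) *: W) - sigma X - t *: sigma_d1 X H))
   @ 0^'+).

Definition signed_perm_mx (R : realType) (n : nat) (Q : 'M[R]_n) : Prop :=
  [/\ forall i j, Q i j \in [:: 0; 1; -1],
      forall i, exists! j, Q i j != 0 &
      forall j, exists! i, Q i j != 0].

Definition absolutely_symmetric (R : realType) (n : nat)
    (f : 'cV[R]_n -> \bar R) : Prop :=
  forall (Q : 'M[R]_n) (x : 'cV[R]_n), signed_perm_mx Q -> f (Q *m x) = f x.

Section VariationalAnalysis.
Context {R : realType} {p q : nat}.
Local Notation E := 'M[R]_(p, q).
Implicit Types (g : E -> \bar R) (x w z : E) (C : set E).

Definition edom g : set E := [set x | (g x < +oo)%E].

Definition locally_lipschitz_rel_dom g : Prop :=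
  forall xbar, edom g xbar ->
    g xbar \is a fin_num /\
    exists (l : R) (O : set E),
      [/\ 0 <= l, nbhs xbar O &
          forall x y, (O `&` edom g) x -> (O `&` edom g) y ->
            (`|g x - g y| <= (l * frobenius_norm (x - y)%R)%:E)%E].

Definition tangent_cone C x : set E :=
  [set w | exists t_ : nat -> R, exists w_ : nat -> E,
     [/\ forall k, 0 < t_ k, t_ @ \oo --> 0, w_ @ \oo --> w &
         forall k, C (x + t_ k *: w_ k)]].

(* When [g x] (and, for the second quotient, [subderivative g x w]) is finite,
   no sum +oo - oo occurs in the two difference quotients below. *)

Definition subderivative g x w : \bar R :=
  limf_einf (fun tw : R * E => (tw.1^-1)%:E * (g (x + tw.1 *: tw.2)%R - g x))%E
    (filter_prod 0^'+ (nbhs w)).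

Definition parabolic_quotient g x w (tau : R) z : \bar R :=
  (((2^-1 * tau ^+ 2)^-1)%:E *
   (g (x + tau *: w + (2^-1 * tau ^+ 2) *: z)%R - g x
    - tau%:E * subderivative g x w))%E.

Definition parabolic_subderivative g x w z : \bar R :=
  limf_einf (fun tz : R * E => parabolic_quotient g x w tz.1 tz.2)
    (filter_prod 0^'+ (nbhs z)).

(* The first two conditions are those under which the parabolic subderivative
   at [x] for [w] is defined. *)
Definition parabolically_epi_differentiable g x w : Prop :=
  [/\ g x \is a fin_num,
      subderivative g x w \is a fin_num,
      edom (parabolic_subderivative g x w) !=set0 &
      forall z (tau_ : nat -> R), (forall k, 0 < tau_ k) -> tau_ @ \oo --> 0 ->
        exists2 z_ : nat -> E, z_ @ \oo --> z &
          (fun k => parabolic_quotient g x w (tau_ k) (z_ k)) @ \oo -->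
            parabolic_subderivative g x w z].

End VariationalAnalysis.

(* Main.v *)
Require Import Defs.
From mathcomp Require Import all_boot all_order all_algebra.
From mathcomp Require Import all_classical all_reals all_analysis.
From mathcomp Require Import perm complex.
From mathcomp Require Import ring lra.

Set Implicit Arguments.
Unset Strict Implicit.
Unset Printing Implicit Defensive.

Import Order.TTheory GRing.Theory Num.Theory.
Import numFieldNormedType.Exports.

Local Open Scope classical_set_scope.
Local Open Scope ring_scope.

(** Why the theorem is true.  Write s = sigma X, d = sigma'(X; H), and, for
    t > 0 and a matrix W',
      z'(t, W') = (sigma (X + t H + t^2/2 W') - s - t d) / (t^2/2).
    By construction f o sigma at X + t H + t^2/2 W' is f at s + t d + t^2/2 z',
    so, once the subderivatives of f o sigma and of f are known to agree, the
    parabolic quotient of f o sigma at (t, W') is that of f at (t, z'(t, W')).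
    Two facts then identify the lower limits as (t, W') tends to (0+, W) and
    as (t, z') tends to (0+, sigma''(X; H, W)):
    - sigma is Lipschitz (sigma_lipschitz), so z'(t, W') tends to
      sigma''(X; H, W) as soon as it does so for W' = W;
    - conversely every z' is attained in the sense that matters for f: if
      M = X + t H + t^2/2 W has the singular value decomposition
      P diag(sigma M) V^T, replacing sigma M by y = s + t d + t^2/2 z' gives a
      matrix at distance O(|y - sigma M|) from M on which f o sigma takes the
      value f y, by absolute symmetry (exists_matrix_over_vector).  Its
      direction W' is thus close to W when z' is close to sigma''(X; H, W).
    The same argument one order lower gives the equality of subderivatives
    (both are instances of limf_einf_sigma), and applied along a sequence it
    turns recovery sequences for f into recovery sequences for f o sigma.  To
    see that the parabolic subderivative of f o sigma is not identically +oo,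
    a recovery sequence for f at a point z of its domain is lifted starting
    from W' = 0: the lifted directions are bounded, and at any cluster point
    of theirs the parabolic subderivative is < +oo.

    What remains is that the limits defining sigma' and sigma'' exist.  Along a
    polynomial curve of matrices a singular value is a continuous algebraic
    function of t, so its difference with any polynomial in t has a constant
    sign for small t > 0 (algebraic_function_sign).  Hence a difference
    quotient of any order is eventually above or eventually below any given
    constant, and it converges as soon as it is bounded.  At first order
    boundedness is the Lipschitz property; at second order it says that an
    eigenvalue l(t) of A + t B, with A and B symmetric, which has a first
    order expansion a + b t + o(t) satisfies l(t) = a + b t + O(t^2)
    (eigenvalue_second_order).  That is applied to the symmetric dilation
    [[0, X], [X^T, 0]], of which every singular value of X is an eigenvalue. *)

(** * The spectral theorem for real symmetric matrices *)

Lemma dot_row_ge0 (R : realType) n (v : 'rV[R]_n) : 0 <= (v *m v^T) 0 0.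
Proof. by rewrite mxE sumr_ge0 // => i _; rewrite mxE -expr2 sqr_ge0. Qed.

Lemma dot_row_eq0 (R : realType) n (v : 'rV[R]_n) :
  ((v *m v^T) 0 0 == 0) = (v == 0).
Proof.
apply/eqP/eqP => [|->]; last by rewrite mul0mx mxE.
rewrite mxE => /psumr_eq0P H; apply/rowP => i; rewrite mxE; apply/eqP.
have := H _ i isT; rewrite mxE -expr2 => e; rewrite -sqrf_eq0 e // => j _.
by rewrite mxE -expr2 sqr_ge0.
Qed.

(** A complex eigenvector w = a + i b for the eigenvalue z always exists.
    Comparing a S b^T with its transpose gives Im z (|a|^2 + |b|^2) = 0, so z
    is real and a or b is a real eigenvector. *)
Lemma symmetric_eigenvector (R : realType) n (S : 'M[R]_n.+1) : S^T = S ->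
  exists2 v : 'rV[R]_n.+1, v != 0 & exists l : R, v *m S = l *: v.
Proof.
move=> Ssym.
pose io := @real_complex R.
have [z /eigenvalueP[w wS w0]] :
    exists z : R[i], eigenvalue (map_mx io S) z.
  have /closed_rootP[z] : size (char_poly (map_mx io S)) != 1.
    by rewrite size_char_poly.
  by rewrite -eigenvalue_root_char; exists z.
pose a : 'rV[R]_n.+1 := map_mx (@complex.Re R) w.
pose b : 'rV[R]_n.+1 := map_mx (@complex.Im R) w.
have sumRe (F : 'I_n.+1 -> R[i]) :
    complex.Re (\sum_i F i) = \sum_i complex.Re (F i) by rewrite raddf_sum.
have sumIm (F : 'I_n.+1 -> R[i]) :
    complex.Im (\sum_i F i) = \sum_i complex.Im (F i) by rewrite raddf_sum.
have ReMr (x : R[i]) r : complex.Re (x * io r) = complex.Re x * r.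
  by case: x => p q; rewrite /= mulr0 subr0.
have ImMr (x : R[i]) r : complex.Im (x * io r) = complex.Im x * r.
  by case: x => p q; rewrite /= mulr0 add0r mulrC.
have ReM (x y : R[i]) : complex.Re (x * y) =
    complex.Re x * complex.Re y - complex.Im x * complex.Im y.
  by case: x y => p q [].
have ImM (x y : R[i]) : complex.Im (x * y) =
    complex.Re x * complex.Im y + complex.Im x * complex.Re y.
  by case: x y => p q [].
have aS : a *m S = complex.Re z *: a - complex.Im z *: b.
  apply/rowP => j; move/rowP/(_ j)/(congr1 (@complex.Re R)) : wS.
  rewrite !mxE sumRe ReM => <-; apply: eq_bigr => i _.
  by rewrite !mxE ReMr.
have bS : b *m S = complex.Im z *: a + complex.Re z *: b.
  apply/rowP => j; move/rowP/(_ j)/(congr1 (@complex.Im R)) : wS.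
  rewrite !mxE sumIm ImM addrC => <-; apply: eq_bigr => i _.
  by rewrite !mxE ImMr.
have y0 : complex.Im z = 0.
  have e : a *m S *m b^T = (b *m S *m a^T)^T.
    by rewrite !trmx_mul trmxK Ssym mulmxA.
  move/matrixP/(_ 0 0): e; rewrite aS bS mulmxBl mulmxDl -!scalemxAl.
  have -> : b *m a^T = (a *m b^T)^T by rewrite trmx_mul trmxK.
  have := dot_row_eq0 a; have := dot_row_ge0 a.
  have := dot_row_eq0 b; have := dot_row_ge0 b.
  move: (a *m a^T) (b *m b^T) (a *m b^T) => p q r q0 qE p0 pE.
  rewrite !mxE => e.
  have {}e : complex.Im z * (p 0 0 + q 0 0) = 0 by lra.
  move/eqP: e; rewrite mulf_eq0 paddr_eq0 // pE qE.
  case/orP => [/eqP//|/andP[/eqP az /eqP bz]].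
  case/eqP: w0; apply/rowP => i; apply/eqP; rewrite eq_complex.
  have /rowP/(_ i) := az; have /rowP/(_ i) := bz.
  by rewrite !mxE => -> ->; rewrite eqxx.
rewrite y0 !scale0r ?subr0 ?add0r in aS bS.
have [az|?] := eqVneq a 0; last by exists a => //; exists (complex.Re z).
exists b; last by exists (complex.Re z).
apply: contra w0 => /eqP bz; apply/eqP/rowP => i; apply/eqP.
rewrite eq_complex.
have /rowP/(_ i) := az; have /rowP/(_ i) := bz.
by rewrite !mxE => -> ->; rewrite eqxx.
Qed.

Lemma gram_entry (R : realType) m n (Y : 'M[R]_(m, n)) i j :
  (Y^T *m Y) i j = ((col i Y)^T *m col j Y) 0 0.
Proof. by rewrite !mxE; apply: eq_bigr => k _; rewrite !mxE. Qed.

(** A vanishing column makes the rank of [Y] smaller than [m], which leaves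
    room for a unit vector orthogonal to all the columns. *)
Lemma exists_unit_orthogonal (R : realType) m n (Y : 'M[R]_(m, n)) j :
  (n <= m)%N -> col j Y = 0 ->
  exists u : 'cV[R]_m, u^T *m Y = 0 /\ (u^T *m u) 0 0 = 1.
Proof.
move=> nm Yj.
have : kermx Y != 0.
  rewrite kermx_eq0 /row_free; apply/eqP => rY.
  have fY : row_free Y^T.
    by rewrite /row_free mxrank_tr rY eqn_leq nm -{1}rY rank_leq_col.
  have := row_free_inj fY (_ : delta_mx 0 j *m Y^T = (0 : 'rV_n) *m Y^T).
  rewrite -rowE mul0mx -tr_col Yj trmx0 => /(_ erefl) /matrixP /(_ 0 j).
  by rewrite !mxE !eqxx => /eqP; rewrite oner_eq0.
case/rowV0Pn => u /sub_kermxP uY u0.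
have s0 : 0 < (u *m u^T) 0 0 by rewrite lt_def dot_row_eq0 u0 dot_row_ge0.
exists ((Num.sqrt ((u *m u^T) 0 0))^-1 *: u^T).
rewrite linearZ /= trmxK; split; first by rewrite -scalemxAl uY scaler0.
rewrite -scalemxAl -scalemxAr scalerA mxE -expr2 exprVn sqr_sqrtr ?ltW //.
by rewrite mulVf ?gt_eqF.
Qed.

(** The Gram matrix says that the columns of [Y] selected by [e] are
    orthonormal and that the others vanish.  Each vanishing column in turn is
    replaced by a unit vector orthogonal to all the columns. *)
Lemma orthonormal_completion (R : realType) m n (Y : 'M[R]_(m, n))
    (e : pred 'I_n) : (n <= m)%N ->
  Y^T *m Y = diag_mx (\row_i (e i)%:R) ->
  exists2 P : 'M[R]_(m, n), P^T *m P = 1%:M &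
    forall i, e i -> col i P = col i Y.
Proof.
move=> nm; move: {2}(#|predC e|) (leqnn #|predC e|) => k.
elim: k Y e => [|k IH] Y e.
  rewrite leqn0 => /eqP /card0_eq ce YY; exists Y => //.
  rewrite YY; apply/matrixP => i j; rewrite !mxE.
  by have := ce i; rewrite !inE => /negbFE ->.
move=> ek YY.
have [/existsP[/= j ej]|] := boolP [exists j : 'I_n, ~~ e j]; last first.
  rewrite negb_exists => /forallP ae; exists Y => //.
  by rewrite YY; apply/matrixP => i j; rewrite !mxE; have /negbNE -> := ae i.
have Yj : col j Y = 0.
  apply/eqP; rewrite -trmx_eq0 -dot_row_eq0 trmxK -gram_entry YY !mxE eqxx.
  by rewrite (negbTE ej).
have [u [uY uu]] := exists_unit_orthogonal nm Yj.
pose Z : 'M[R]_(m, n) := \matrix_(a, b) if b == j then u a 0 else Y a b.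
have colZj : col j Z = u by apply/colP => a; rewrite !mxE eqxx.
have colZ (b : 'I_n) : b != j -> col b Z = col b Y.
  by move=> bj; apply/colP => a; rewrite !mxE (negbTE bj).
have [||P PP PZ] := IH Z [predU1 j & e].
- rewrite -ltnS; apply: leq_trans ek; apply: proper_card; apply/properP.
  split; first by apply/fintype.subsetP => x; rewrite !inE negb_or => /andP[].
  by exists j; rewrite !inE ?eqxx.
- apply/matrixP => a b; rewrite gram_entry.
  have uYb c : (u^T *m col c Y) 0 0 = 0.
    by rewrite colE mulmxA uY mul0mx mxE.
  rewrite [RHS]mxE /=; have [->|aj] := eqVneq a j.
    rewrite colZj; have [<-|bj] := eqVneq j b.
      by rewrite colZj uu !mxE eqxx.
    by rewrite colZ 1?eq_sym // uYb mulr0n.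
  rewrite colZ //; have [->|bj] := eqVneq b j.
    rewrite colZj (negbTE aj) mulr0n.
    have -> : (col a Y)^T *m u = (u^T *m col a Y)^T by rewrite trmx_mul trmxK.
    by rewrite mxE uYb.
  by rewrite colZ // -gram_entry YY !mxE /= (negbTE aj).
exists P => // i ei; rewrite PZ /= ?colZ //; last by apply/orP; right.
by apply: contraNneq ej => <-.
Qed.

(** Induction on the size: completing a unit eigenvector to an orthogonal
    matrix splits off a 1 x 1 block, since the complement of an eigenvector of
    a symmetric matrix is invariant. *)
Theorem symmetric_spectral (R : realType) n (S : 'M[R]_n) : S^T = S ->
  exists2 V : 'M[R]_n, V^T *m V = 1%:M &
    exists d : 'rV[R]_n, S = V *m diag_mx d *m V^T.
Proof.
elim: n S => [|n IH] S Ssym.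
  by exists 1%:M; [rewrite trmx1 mulmx1|exists 0]; apply/matrixP=> -[].
have [v v0 [l vS]] := symmetric_eigenvector Ssym.
pose c := Num.sqrt ((v *m v^T) 0 0).
have c0 : 0 < (v *m v^T) 0 0 by rewrite lt_def dot_row_eq0 v0 dot_row_ge0.
pose Y : 'M[R]_n.+1 := \matrix_(i, j) if j == 0 then c^-1 * v 0 i else 0.
have colY0 : col 0 Y = c^-1 *: v^T by apply/colP => i; rewrite !mxE.
have [|P PP PY] := @orthonormal_completion R _ _ Y (pred1 0) (leqnn _).
  apply/matrixP => a b; rewrite !mxE.
  have [-> | a0] := eqVneq a 0; last first.
    rewrite /= (negbTE a0) mul0rn big1 // => i _.
    by rewrite !mxE (negbTE a0) mul0r.
  have [<- | b0] := eqVneq 0 b; last first.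
    rewrite /= big1 ?mulr0n // => i _.
    by rewrite !mxE eq_sym (negbTE b0) mulr0.
  have e : c^-1 ^+ 2 * (v *m v^T) 0 0 = 1.
    by rewrite exprVn /c sqr_sqrtr ?ltW // mulVf ?gt_eqF.
  rewrite /= mulr1n -e mxE mulr_sumr; apply: eq_bigr => i _; rewrite !mxE /=.
  ring.
have PP' : P *m P^T = 1%:M by apply: mulmx1C.
have P0 : col 0 P = c^-1 *: v^T by rewrite PY // colY0.
have SP0 : S *m col 0 P = l *: col 0 P.
  rewrite P0 -scalemxAr -{1}Ssym -trmx_mul vS linearZ /= scalerA mulrC.
  by rewrite scalerA.
pose T : 'M[R]_(1 + n) := P^T *m S *m P.
have Tsym : T^T = T by rewrite /T !trmx_mul trmxK Ssym mulmxA.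
have T0 : col 0 T = l *: delta_mx 0 0.
  have -> : col 0 T = P^T *m (S *m col 0 P) by rewrite !colE !mulmxA.
  by rewrite SP0 -scalemxAr colE mulmxA PP mul1mx.
have Tl i j : T i (lshift n j) = l *+ (i == 0).
  rewrite (_ : lshift n j = 0); last by apply: val_inj; rewrite /= ord1.
  by have /colP/(_ i) := T0; rewrite mxE => ->; rewrite !mxE andbT mulr_natr.
have Tul : ulsubmx T = l%:M.
  by apply/matrixP => i j; rewrite mxE mxE Tl !ord1 mxE.
have Tdl : dlsubmx T = 0.
  by apply/matrixP => i j; rewrite mxE mxE Tl mxE.
have Tur : ursubmx T = 0 by rewrite -[LHS]trmxK trmx_ursub Tsym Tdl trmx0.
have Tdr : (drsubmx T)^T = drsubmx T by rewrite trmx_drsub Tsym.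
have [V VV [d dE]] := IH _ Tdr.
pose Q : 'M[R]_(1 + n) := block_mx 1%:M 0 0 V.
have QQ : Q^T *m Q = 1%:M.
  rewrite /Q tr_block_mx mulmx_block !trmx0 !(mulmx0, mul0mx, addr0, add0r).
  by rewrite VV trmx1 mulmx1 -scalar_mx_block.
exists (P *m Q); first by rewrite trmx_mul mulmxA -(mulmxA _ P^T) PP mulmx1.
exists (row_mx (l%:M) d).
have TE : T = Q *m diag_mx (row_mx l%:M d) *m Q^T.
  rewrite -[LHS]submxK Tul Tdl Tur dE diag_mx_row /Q tr_block_mx.
  rewrite !mulmx_block !trmx0 !(mulmx0, mul0mx, addr0, add0r) trmx1 mul1mx.
  congr block_mx; rewrite mulmx1; apply/matrixP => i j.
  by rewrite !ord1 !mxE.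
have -> : S = P *m T *m P^T by rewrite /T !mulmxA PP' mul1mx -mulmxA PP' mulmx1.
by rewrite TE trmx_mul !mulmxA.
Qed.

(** * Singular value decomposition *)

Lemma ler_mx_norm_entry (R : realType) m n (M : 'M[R]_(m, n)) i j :
  `|M i j| <= `|M|.
Proof.
rewrite [leRHS]/Num.Def.normr /= mx_normrE; apply/bigmax_geP; right => /=.
by exists (i, j).
Qed.

Lemma mx_norm_le (R : realType) m n (M : 'M[R]_(m, n)) c : 0 <= c ->
  (forall i j, `|M i j| <= c) -> `|M| <= c.
Proof.
move=> c0 Mc; rewrite [leLHS]/Num.Def.normr /= mx_normrE.
by apply: bigmax_le => // -[i j] _ /=; exact: Mc.
Qed.

Lemma char_poly_conj_diag (R : realType) n (V : 'M[R]_n) (d : 'rV[R]_n) :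
  V^T *m V = 1%:M ->
  char_poly (V *m diag_mx d *m V^T) = \prod_(i < n) ('X - (d 0 i)%:P).
Proof.
move=> VV; transitivity (char_poly (diag_mx d)); last first.
  rewrite char_poly_trig ?diag_mx_is_trig //.
  by apply: eq_bigr => i _; rewrite mxE eqxx mulr1n.
set W := map_mx polyC V.
have WW : W *m W^T = 1%:M.
  by rewrite /W map_trmx -map_mxM (mulmx1C VV) map_scalar_mx.
have dW : \det W * \det W^T = 1 by rewrite -det_mulmx WW det1.
rewrite /char_poly /char_poly_mx -[RHS]mul1r -dW mulrAC.
rewrite -!det_mulmx mulmxBr mulmxBl !map_mxM -/W -map_trmx.
congr (\det (_ - _)).
by rewrite mul_mx_scalar -scalemxAl WW scalemx1.
Qed.

Lemma prod_XsubC_perm (R : realType) n (a b : 'I_n -> R) :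
  \prod_(i < n) ('X - (a i)%:P) = \prod_(i < n) ('X - (b i)%:P) ->
  exists s : 'S_n, forall i, a i = b (s i).
Proof.
move=> ab.
have pab : perm_eq [seq a i | i <- enum 'I_n] [seq b i | i <- enum 'I_n].
  by apply: prod_XsubC_eq; rewrite [LHS]big_map [RHS]big_map !big_enum.
have /tuple_permP[s sE] :
    perm_eq (map_tuple a (ord_tuple n)) (map_tuple b (ord_tuple n)).
  exact: pab.
exists s => i; have /(congr1 (fun t => tnth t i)) := val_inj sE.
by rewrite tnth_mktuple !tnth_map !tnth_ord_tuple.
Qed.

Lemma mul_diag_entry (R : realType) m n p (A : 'M[R]_(m, n)) d
    (B : 'M[R]_(n, p)) i j :
  (A *m diag_mx d *m B) i j = \sum_k A i k * d 0 k * B k j.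
Proof. by rewrite mxE; apply: eq_bigr => k _; rewrite mul_mx_diag mxE. Qed.

(** The spectral theorem for M^T M, with the eigenvalues put in the order in
    which [sigma] lists their square roots. *)
Lemma gram_spectral (R : realType) m n (M : 'M[R]_(m, n)) :
  exists2 V : 'M[R]_n, V^T *m V = 1%:M &
    M^T *m M = V *m diag_mx (\row_i (sigma M i 0 ^+ 2)) *m V^T.
Proof.
have [|V VV [d dE]] := @symmetric_spectral R n (M^T *m M).
  by rewrite trmx_mul trmxK.
have [_ _] := sigmaP M; rewrite dE char_poly_conj_diag //.
case/esym/prod_XsubC_perm => s sE.
exists (col_perm s V).
  apply/matrixP => i j; have /matrixP/(_ (s i) (s j)) := VV.
  rewrite !mxE (inj_eq perm_inj) => <-.
  by apply: eq_bigr => k _; rewrite !mxE.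
apply/matrixP => i j; rewrite !mul_diag_entry (reindex_inj (@perm_inj _ s)).
by apply: eq_bigr => k _; rewrite !mxE sE.
Qed.

(** The columns of M V are orthogonal with lengths sigma M; dividing by the
    nonzero lengths gives the corresponding columns of [P], and
    orthonormal_completion supplies those for the zero singular values. *)
Theorem thin_svd (R : realType) m n (M : 'M[R]_(m, n)) : (n <= m)%N ->
  exists P : 'M[R]_(m, n), exists V : 'M[R]_n,
    [/\ P^T *m P = 1%:M, V^T *m V = 1%:M &
        M = P *m diag_mx (sigma M)^T *m V^T].
Proof.
move=> nm; have [V VV ME] := gram_spectral M.
set s := sigma M; set Y := M *m V.
have YY : Y^T *m Y = diag_mx (\row_i (s i 0 ^+ 2)).
  rewrite /Y trmx_mul -mulmxA (mulmxA M^T) ME !mulmxA VV mul1mx.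
  by rewrite -mulmxA VV mulmx1.
have [|P PP PE] := @orthonormal_completion R _ _
  (Y *m diag_mx (\row_i (s i 0)^-1)) (fun i => s i 0 != 0) nm.
  rewrite trmx_mul tr_diag_mx -mulmxA (mulmxA Y^T) YY !mulmx_diag.
  congr diag_mx; apply/rowP => i; rewrite !mxE.
  by have [->|si] := eqVneq; rewrite ?invr0 ?mul0r //= expr2 mulfK // mulVf.
exists P, V; split => //.
rewrite -[LHS]mulmx1 -(mulmx1C VV) mulmxA; congr (_ *m _); rewrite -/Y.
apply/matrixP => i j; rewrite mul_mx_diag !mxE -/s.
have [sj|sj] := eqVneq (s j 0) 0.
  rewrite sj mulr0; have : col j Y = 0.
    apply/eqP; rewrite -trmx_eq0 -dot_row_eq0 trmxK -gram_entry YY !mxE eqxx.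
    by rewrite sj expr0n.
  by move/colP/(_ i); rewrite !mxE.
have := PE j sj; move/colP/(_ i); rewrite mul_mx_diag !mxE => ->.
by rewrite mulfVK.
Qed.

(** The singular values of P diag(y) V^T are the absolute values of the
    entries of [y] in nonincreasing order, that is, the image of [y] by a
    signed permutation. *)
Lemma abs_sym_sigma (R : realType) m n (P : 'M[R]_(m, n)) (V : 'M[R]_n)
    (y : 'cV[R]_n) (f : 'cV[R]_n -> \bar R) :
  P^T *m P = 1%:M -> V^T *m V = 1%:M -> absolutely_symmetric f ->
  f (sigma (P *m diag_mx y^T *m V^T)) = f y.
Proof.
move=> PP VV fsym; set Z := P *m _ *m _.
have [s0 _] := sigmaP Z.
have -> : Z^T *m Z = V *m diag_mx (\row_i (y i 0 ^+ 2)) *m V^T.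
  rewrite /Z !trmx_mul trmxK tr_diag_mx !mulmxA; congr (_ *m _).
  rewrite -!mulmxA; congr (_ *m _); rewrite mulmxA.
  rewrite mulmxA -(mulmxA (diag_mx _)) PP mulmx1 mulmx_diag; congr diag_mx.
  by apply/rowP => i; rewrite !mxE.
rewrite char_poly_conj_diag // => /esym /prod_XsubC_perm [s sE].
pose e (x : R) : R := if 0 <= x then 1 else -1.
pose Q : 'M[R]_n := \matrix_(i, j) if j == s i then e (y j 0) else 0.
have e0 x : e x != 0 by rewrite /e; case: ifP; rewrite ?oppr_eq0 oner_eq0.
have QE i j : (Q i j != 0) = (j == s i).
  by rewrite mxE; case: ifP; rewrite ?eqxx ?e0.
rewrite -(fsym Q y); last first.
  split=> [i j|i|j].
  - by rewrite mxE /e; do 2?case: ifP; rewrite !inE eqxx ?orbT.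
  - by exists (s i); split=> [|j]; rewrite QE ?eqxx // => /eqP.
  - exists ((s^-1)%g j); split=> [|i]; rewrite QE ?permKV ?eqxx // => /eqP ->.
    by rewrite permK.
congr f; apply/colP => i; rewrite mxE (bigD1 (s i)) //= big1; last first.
  by move=> j jsi; rewrite mxE (negbTE jsi) mul0r.
rewrite mxE eqxx addr0.
have -> : sigma Z i 0 = `|y (s i) 0|.
  have := sE i; rewrite mxE => /(congr1 Num.sqrt).
  by rewrite !sqrtr_sqr ger0_norm.
by rewrite /e; case: ifP => y0; [rewrite mul1r ger0_norm|
  rewrite mulN1r ltr0_norm // ltNge y0].
Qed.

Lemma orthonormal_entry (R : realType) m n (P : 'M[R]_(m, n)) i j :
  P^T *m P = 1%:M -> `|P i j| <= 1.
Proof.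
move=> /matrixP/(_ j j); rewrite !mxE eqxx (bigD1 i) //= mxE mulr1n => e.
rewrite -(@expr_le1 _ 2) // real_normK ?num_real // expr2 -e lerDl.
by apply: sumr_ge0 => k _; rewrite mxE -expr2 sqr_ge0.
Qed.

(** Keeping the singular vectors of [M] and prescribing the entries of [y]
    as new singular values (up to sign and order) moves [M] no further, up to
    a constant, than [y] is from [sigma M].  This is what lets points of R^n be
    lifted to matrices. *)
Lemma exists_matrix_over_vector (R : realType) m n (M : 'M[R]_(m, n))
    (y : 'cV[R]_n) : (n <= m)%N ->
  exists2 Z : 'M[R]_(m, n), `|Z - M| <= n%:R * `|y - sigma M| &
    forall f, absolutely_symmetric f -> f (sigma Z) = f y.
Proof.
move=> nm; have [P [V [PP VV ME]]] := thin_svd M nm.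
exists (P *m diag_mx y^T *m V^T); last by move=> f fs; exact: abs_sym_sigma.
have -> : P *m diag_mx y^T *m V^T - M = P *m diag_mx (y - sigma M)^T *m V^T.
  by rewrite {1}ME -mulmxBl -mulmxBr !linearB.
apply: mx_norm_le => [|i j]; first by rewrite mulr_ge0.
rewrite mul_diag_entry; apply: le_trans (ler_norm_sum _ _ _) _.
have -> : n%:R * `|y - sigma M| = \sum_(k < n) `|y - sigma M|.
  by rewrite sumr_const card_ord mulr_natl.
apply: ler_sum => k _; rewrite !normrM mulrAC [V^T _ _]mxE [_^T _ _]mxE.
apply: le_trans (ler_mx_norm_entry (y - sigma M) k 0).
by rewrite ler_piMl // mulr_ile1 // orthonormal_entry.
Qed.

(** * Lipschitz continuity of the singular values *)

(** Minkowski's inequality for the Euclidean norm, in squared form. *)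
Lemma dot_rowD_le (R : realType) n (p q : 'rV[R]_n) b c : 0 <= b -> 0 <= c ->
  (p *m p^T) 0 0 <= b ^+ 2 -> (q *m q^T) 0 0 <= c ^+ 2 ->
  ((p + q) *m (p + q)^T) 0 0 <= (b + c) ^+ 2.
Proof.
move=> b0 c0.
have dotE (r : 'rV[R]_n) : (r *m r^T) 0 0 = \sum_i r 0 i ^+ 2.
  by rewrite mxE; apply: eq_bigr => i _; rewrite mxE expr2.
rewrite !dotE => pb qc.
have -> : \sum_i (p + q) 0 i ^+ 2 =
    \sum_i p 0 i ^+ 2 + \sum_i q 0 i ^+ 2 + 2 * \sum_i p 0 i * q 0 i.
  rewrite mulr_sumr -!big_split /=; apply: eq_bigr => i _; rewrite mxE; ring.
suff : \sum_i p 0 i * q 0 i <= b * c by move=> pq; rewrite sqrrD; lra.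
have zero (r s : 'rV[R]_n) : \sum_i r 0 i ^+ 2 <= 0 ->
    \sum_i r 0 i * s 0 i = 0.
  rewrite -dotE => r0; have : (r *m r^T) 0 0 == 0.
    by rewrite eq_le r0 dot_row_ge0.
  by rewrite dot_row_eq0 => /eqP ->; apply: big1 => i _; rewrite mxE mul0r.
have [bz|bn0] := eqVneq b 0.
  by rewrite zero ?bz ?mul0r // (le_trans pb) // bz expr0n.
have [cz|cn0] := eqVneq c 0.
  under eq_bigr do rewrite mulrC.
  by rewrite zero ?cz ?mulr0 // (le_trans qc) // cz expr0n.
have bp : 0 < b by rewrite lt_def bn0.
have cp : 0 < c by rewrite lt_def cn0.
have : \sum_i (2 * b * c * (p 0 i * q 0 i)) <=
       \sum_i (c ^+ 2 * p 0 i ^+ 2 + b ^+ 2 * q 0 i ^+ 2).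
  by apply: ler_sum => i _; have := sqr_ge0 (c * p 0 i - b * q 0 i); lra.
rewrite big_split /= -!mulr_sumr => h.
have bc : 0 < b * c by rewrite mulr_gt0.
rewrite -(ler_pM2l bc); nra.
Qed.

Lemma sigma_quadratic_form (R : realType) m n (M : 'M[R]_(m, n))
    (V : 'M[R]_n) (v : 'rV[R]_n) :
  M^T *m M = V *m diag_mx (\row_i (sigma M i 0 ^+ 2)) *m V^T ->
  ((v *m M^T) *m (v *m M^T)^T) 0 0 =
    \sum_k (v *m V) 0 k ^+ 2 * sigma M k 0 ^+ 2.
Proof.
move=> ME.
have -> : (v *m M^T) *m (v *m M^T)^T =
    (v *m V) *m diag_mx (\row_i (sigma M i 0 ^+ 2)) *m (v *m V)^T.
  by rewrite !trmx_mul trmxK !mulmxA -(mulmxA v) ME !mulmxA.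
rewrite mul_diag_entry; apply: eq_bigr => k _; rewrite [_^T _ _]mxE.
rewrite [(\row_i _) _ _]mxE; ring.
Qed.

(** Weyl's inequality, by comparing |v M^T| and |v N^T| on one unit vector [v]
    that has no component along the right singular vectors of [M] after the
    [i]-th nor along those of [N] before the [i]-th.  These are [n.-1] linear
    conditions on a vector of length [n], so such a [v] exists. *)
Lemma sigma_le_add (R : realType) m n (M N : 'M[R]_(m, n)) c i :
  0 <= c ->
  (forall v : 'rV[R]_n, (v *m v^T) 0 0 = 1 ->
     ((v *m (M - N)^T) *m (v *m (M - N)^T)^T) 0 0 <= c ^+ 2) ->
  sigma M i 0 <= sigma N i 0 + c.
Proof.
move=> c0 Hc.
have [VM VVM ME] := gram_spectral M; have [VN VVN NE] := gram_spectral N.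
have [sM0 sM _] := sigmaP M; have [sN0 sN _] := sigmaP N.
(* v has to be orthogonal to all the columns of T, the i-th of which is free *)
pose T : 'M[R]_n := \matrix_(j, k)
  if (k < i)%N then VN j k else if (i < k)%N then VM j k else 0.
have [|u [uT uu]] := exists_unit_orthogonal (leqnn n) (_ : col i T = 0).
  by apply/colP => j; rewrite !mxE ltnn.
pose v := u^T.
have vv : (v *m v^T) 0 0 = 1 by rewrite /v trmxK.
have sumsq (V : 'M[R]_n) : V^T *m V = 1%:M -> \sum_k (v *m V) 0 k ^+ 2 = 1.
  move=> VV; have -> : 1 = ((v *m V) *m (v *m V)^T) 0 0.
    by rewrite trmx_mul mulmxA -(mulmxA v) (mulmx1C VV) mulmx1.
  by rewrite mxE; apply: eq_bigr => k _; rewrite expr2 [X in _ = _ * X]mxE.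
have aM (k : 'I_n) : (i < k)%N -> (v *m VM) 0 k = 0.
  move=> ik; have /rowP/(_ k) := uT; rewrite mxE [RHS]mxE => <-.
  rewrite mxE; apply: eq_bigr => j _.
  by rewrite [T _ _]mxE ik ltnNge ltnW.
have aN (k : 'I_n) : (k < i)%N -> (v *m VN) 0 k = 0.
  move=> ki; have /rowP/(_ k) := uT; rewrite mxE [RHS]mxE => <-.
  rewrite mxE; apply: eq_bigr => j _; by rewrite [T _ _]mxE ki.
have lowM : sigma M i 0 ^+ 2 <= ((v *m M^T) *m (v *m M^T)^T) 0 0.
  rewrite (sigma_quadratic_form v ME) -[leLHS]mul1r -(sumsq _ VVM) mulr_suml.
  apply: ler_sum => k _; have [ik|ki] := ltnP i k.
    by rewrite aM // expr0n !mul0r.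
  by rewrite ler_wpM2l ?sqr_ge0 // ler_pXn2r ?nnegrE // sM.
have upN : ((v *m N^T) *m (v *m N^T)^T) 0 0 <= sigma N i 0 ^+ 2.
  rewrite (sigma_quadratic_form v NE) -[leRHS]mul1r -(sumsq _ VVN) mulr_suml.
  apply: ler_sum => k _; have [ki|ik] := ltnP k i.
    by rewrite aN // expr0n !mul0r.
  by rewrite ler_wpM2l ?sqr_ge0 // ler_pXn2r ?nnegrE // sN.
have := dot_rowD_le (sN0 i) c0 upN (Hc v vv).
rewrite -mulmxDr -linearD /= addrC subrK => /(le_trans lowM).
by rewrite ler_pXn2r ?nnegrE ?addr_ge0.
Qed.

Theorem sigma_lipschitz (R : realType) m n (M N : 'M[R]_(m, n)) :
  `|sigma M - sigma N| <= (m * n)%:R * `|M - N|.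
Proof.
have half (A B : 'M[R]_(m, n)) i :
    sigma A i 0 <= sigma B i 0 + (m * n)%:R * `|A - B|.
  apply: sigma_le_add => [|v vv]; first by rewrite mulr_ge0.
  have v1 k : `|v 0 k| <= 1.
    have := @orthonormal_entry R n 1 v^T k 0; rewrite mxE; apply.
    by apply/matrixP => a b; rewrite !ord1 trmxK vv mxE.
  have e j : `|(v *m (A - B)^T) 0 j| <= n%:R * `|A - B|.
    rewrite mxE; apply: le_trans (ler_norm_sum _ _ _) _.
    have -> : n%:R * `|A - B| = \sum_(k < n) `|A - B|.
      by rewrite sumr_const card_ord mulr_natl.
    apply: ler_sum => k _; rewrite normrM [_^T _ _]mxE.
    by apply: le_trans (ler_mx_norm_entry (A - B) j k); rewrite ler_piMl.
  rewrite mxE; apply: (@le_trans _ _ (\sum_(j < m) (n%:R * `|A - B|) ^+ 2)).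
    apply: ler_sum => j _; rewrite [_^T _ _]mxE -expr2 -real_normK ?num_real //.
    by rewrite ler_pXn2r ?nnegrE // mulr_ge0.
  rewrite sumr_const card_ord -[leLHS]mulr_natl natrM -mulrA [leRHS]exprMn.
  rewrite ler_wpM2r ?sqr_ge0 // -natrX ler_nat -mulnn.
  by case: (m) => // k; rewrite leq_pmull.
apply: mx_norm_le => [|i j]; first by rewrite mulr_ge0.
rewrite ord1 !mxE ler_norml; apply/andP; split.
  by have := half N M i; rewrite distrC; lra.
by have := half M N i; lra.
Qed.

(** * Second-order expansion of eigenvalues and singular values *)

Lemma mx_norm_mulmx (R : realType) m n p (A : 'M[R]_(m, n)) (B : 'M[R]_(n, p)) :
  `|A *m B| <= n%:R * `|B| * `|A|.
Proof.
apply: mx_norm_le => [|i j]; first by rewrite !mulr_ge0.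
rewrite mxE; apply: le_trans (ler_norm_sum _ _ _) _.
have -> : n%:R * `|B| * `|A| = \sum_(k < n) `|A| * `|B|.
  by rewrite sumr_const card_ord -[RHS]mulr_natl; ring.
by apply: ler_sum => k _; rewrite normrM ler_pM ?ler_mx_norm_entry.
Qed.

(** Invert the nonzero eigenvalues and keep the zero ones, which is what
    [_^-1] does.  Then 1 - S G is the orthogonal projection on the kernel of S,
    so G gives access to spectral projections without listing eigenvectors. *)
Lemma symmetric_pseudo_inverse (R : realType) n (S : 'M[R]_n) : S^T = S ->
  exists G : 'M[R]_n, [/\ G^T = G, S *m G *m S = S & G *m S = S *m G].
Proof.
move=> /symmetric_spectral[V VV [d ->]].
have conjM (a b : 'rV[R]_n) : V *m diag_mx a *m V^T *m (V *m diag_mx b *m V^T) =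
    V *m diag_mx (\row_i (a 0 i * b 0 i)) *m V^T.
  rewrite !mulmxA -(mulmxA _ V^T) VV mulmx1 -(mulmxA V) mulmx_diag.
  by congr (_ *m diag_mx _ *m _); apply/rowP => i; rewrite !mxE.
exists (V *m diag_mx (\row_i (d 0 i)^-1) *m V^T); split.
- by rewrite !trmx_mul trmxK tr_diag_mx mulmxA.
- rewrite !conjM; congr (_ *m diag_mx _ *m _); apply/rowP => i; rewrite !mxE.
  by have [->|di] := eqVneq (d 0 i) 0; rewrite ?mulr0 // mulfV // mul1r.
- rewrite !conjM; congr (_ *m diag_mx _ *m _); apply/rowP => i; rewrite !mxE.
  exact: mulrC.
Qed.

(** Let P be the projection on the eigenspace of A for [a], G0 the
    pseudo-inverse of A - a, mu = (l - a) / t and nu = mu - b.  Off the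
    eigenspace an eigenvector v of A + t B is O(t), so w = v P is v + O(t).
    Projecting the eigenvalue equation on the eigenspace shows that w is an
    eigenvector of P B P for mu up to O(t).  If Q is the projection on the
    kernel of S = P B P - b, multiplying by Q gives nu (w Q) = O(t), while
    w - w Q = O(nu + t) is small.  Hence w Q is not small and nu = O(t).
    The threshold [d] says how close to their limits 0 and [b] the numbers t
    and mu must be for these estimates to hold. *)
Theorem eigenvalue_second_order (R : realType) n (A B : 'M[R]_n) (a b : R) :
  A^T = A -> B^T = B ->
  exists C d : R, 0 < d /\ forall (t l : R) (v : 'rV[R]_n),
    0 < t <= d -> v != 0 -> v *m (A + t *: B) = l *: v ->
    `|(l - a) / t - b| <= d -> `|(l - a) / t - b| <= C * t.
Proof.
move=> As Bs; pose A0 := A - a%:M.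
have A0s : A0^T = A0 by rewrite linearB /= tr_scalar_mx As.
have [G0 [G0s AGA AG]] := symmetric_pseudo_inverse A0s.
pose P := 1%:M - A0 *m G0.
have Ps : P^T = P by rewrite linearB /= trmx1 trmx_mul A0s G0s AG.
have AP : A0 *m P = 0 by rewrite mulmxBr mulmx1 -AG mulmxA AGA subrr.
have PP : P *m P = P.
  by rewrite {1}/P mulmxBl mul1mx -AG -mulmxA AP mulmx0 subr0.
pose S := P *m B *m P - b%:M.
have Ss : S^T = S.
  by rewrite linearB /= tr_scalar_mx !trmx_mul Ps Bs mulmxA.
have [G [_ SGS SG]] := symmetric_pseudo_inverse Ss.
pose Q := 1%:M - S *m G.
have SQ : S *m Q = 0 by rewrite mulmxBr mulmx1 -SG mulmxA SGS subrr.
have PE : P = 1%:M - A0 *m G0 by [].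
have QE : Q = 1%:M - S *m G by [].
have SE : S = P *m B *m P - b%:M by [].
have A0E : A0 = A - a%:M by [].
clearbody Q S P A0.
(* Relative to |v|: kB bounds the action of mu - B, since |mu| <= |b| + 1,
   c1 and c2 bound e and e', K3 bounds e' *m Q, and K1 and K2 bound the parts
   of v - w *m Q with factor nu and t; the threshold makes w *m Q keep half
   of the norm of v. *)
pose kB := `|b| + 1 + n%:R * `|B|.
pose c1 := n%:R * `|G0| * kB; pose c2 := n%:R * `|P| * (kB * c1).
pose K1 := n%:R * `|G| * (n%:R * `|P|); pose K2 := n%:R * `|G| * c2 + c1.
pose K3 := n%:R * `|Q| * c2.
have kB0 : 0 <= kB by rewrite !addr_ge0 ?mulr_ge0.
have c10 : 0 <= c1 by rewrite !mulr_ge0.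
have c20 : 0 <= c2 by rewrite !mulr_ge0.
have K10 : 0 <= K1 by rewrite !mulr_ge0.
have K20 : 0 <= K2 by rewrite addr_ge0 // !mulr_ge0.
exists (2 * K3), (4 * (K1 + K2 + 1))^-1; split.
  by rewrite invr_gt0; lra.
move=> t l v /andP[t0 td] v0 vl; set mu := (l - a) / t; set nu := mu - b => nud.
have vp : 0 < `|v| by rewrite normr_gt0.
have d1 : (4 * (K1 + K2 + 1))^-1 <= 1 by rewrite invf_le1; lra.
have nu1 : `|mu| <= `|b| + 1.
  have -> : mu = b + nu by rewrite /nu; ring.
  by apply: le_trans (ler_normD _ _) _; rewrite lerD2l (le_trans nud).
have kBP (x : 'rV[R]_n) : `|x *m (mu%:M - B)| <= kB * `|x|.
  rewrite mulmxBr mul_mx_scalar; apply: le_trans (ler_normB _ _) _.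
  by rewrite normrZ [kB * _]mulrDl lerD ?mx_norm_mulmx // ler_wpM2r.
have vA : v *m A0 = t *: (v *m (mu%:M - B)).
  rewrite A0E !mulmxBr !mul_mx_scalar scalerBr scalerA mulrC divfK ?gt_eqF //.
  by rewrite scalerBl -vl mulmxDr -scalemxAr addrAC addrK.
pose e := v *m (mu%:M - B) *m G0; pose w := v *m P.
pose e' := e *m (mu%:M - B) *m P.
have eE : v = w + t *: e.
  by rewrite /w /e scalemxAl -vA PE mulmxBr mulmx1 -mulmxA subrK.
have wP : w *m P = w by rewrite /w -mulmxA PP.
have wS : w *m S = nu *: w + t *: e'.
  have e0 : v *m (mu%:M - B) *m P = 0.
    have := congr1 (mulmx^~ P) vA.
    rewrite /= -(mulmxA v A0) AP mulmx0 -scalemxAl.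
    by move/esym/eqP; rewrite scaler_eq0 gt_eqF //= => /eqP.
  move: e0; rewrite eE mulmxDl mulmxDl -!scalemxAl -/e' => /eqP.
  rewrite addr_eq0 => /eqP e0; rewrite -[t *: e']opprK -e0.
  have -> : w *m (mu%:M - B) *m P = mu *: w - w *m B *m P.
    by rewrite mulmxBr mulmxBl mul_mx_scalar -scalemxAl wP.
  have -> : w *m S = w *m B *m P - b *: w.
    by rewrite SE mulmxBr mul_mx_scalar !mulmxA wP.
  by rewrite opprB /nu scalerBl [RHS]addrC subrKA.
have wQ : nu *: (w *m Q) = - (t *: (e' *m Q)).
  have := congr1 (mulmx^~ Q) wS; rewrite /= -(mulmxA w S) SQ mulmx0 mulmxDl.
  by rewrite -!scalemxAl => /esym/eqP; rewrite addr_eq0 => /eqP.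
have eb : `|e| <= c1 * `|v|.
  apply: le_trans (mx_norm_mulmx _ _) _.
  by rewrite -[leRHS]mulrA ler_wpM2l ?mulr_ge0.
have e'b : `|e'| <= c2 * `|v|.
  apply: le_trans (mx_norm_mulmx _ _) _.
  rewrite -[leRHS]mulrA ler_wpM2l ?mulr_ge0 // -[leRHS]mulrA.
  apply: le_trans (kBP _) _.
  by rewrite ler_wpM2l.
have wb : `|w| <= n%:R * `|P| * `|v| by exact: mx_norm_mulmx.
clearbody e' e w.
have vE : v = w *m Q + (nu *: (w *m G) + t *: (e' *m G + e)).
  rewrite {1}eE scalerDr !addrA; congr (_ + _).
  by rewrite -addrA !scalemxAl -mulmxDl -wS QE mulmxBr mulmx1 mulmxA subrK.
have vle : `|v| <= `|w *m Q| + (`|nu| * (K1 * `|v|) + t * (K2 * `|v|)).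
  rewrite {1}vE; apply: le_trans (ler_normD _ _) _; rewrite lerD2l.
  apply: le_trans (ler_normD _ _) _; rewrite !normrZ (gtr0_norm t0).
  apply: lerD; [rewrite ler_wpM2l //|rewrite ler_pM2l //].
    apply: le_trans (mx_norm_mulmx _ _) _; rewrite -[K1 * _]mulrA.
    by rewrite ler_wpM2l ?mulr_ge0.
  apply: le_trans (ler_normD _ _) _; rewrite [K2 * _]mulrDl lerD //.
  apply: le_trans (mx_norm_mulmx _ _) _; rewrite -[leRHS]mulrA.
  by rewrite ler_wpM2l ?mulr_ge0.
have half : `|v| <= 2 * `|w *m Q|.
  set dd := _^-1 in td nud; have D : dd * (4 * (K1 + K2 + 1)) = 1.
    by rewrite /dd mulVf //; apply: lt0r_neq0; lra.
  have : `|nu| * K1 + t * K2 <= 1 / 2.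
    have h1 : `|nu| * K1 <= dd * K1 by rewrite ler_wpM2r.
    have h2 : t * K2 <= dd * K2 by rewrite ler_wpM2r.
    have : 0 <= dd by rewrite (le_trans (ltW t0)).
    lra.
  rewrite -(ler_pM2r vp) => h; lra.
have : `|nu| * `|w *m Q| <= t * (K3 * `|v|).
  rewrite -normrZ wQ normrN normrZ (gtr0_norm t0) ler_pM2l //.
  apply: le_trans (mx_norm_mulmx _ _) _; rewrite -[K3 * _]mulrA.
  by rewrite ler_wpM2l ?mulr_ge0.
have : `|nu| * `|v| <= `|nu| * (2 * `|w *m Q|) by rewrite ler_wpM2l.
by move=> h1 h2; rewrite -(ler_pM2r vp); lra.
Qed.

(** The right singular vector [v] and the left one v M^T / sigma form an
    eigenvector; when sigma = 0 the convention 0^-1 = 0 sets the left part to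
    0, which is right because then v M^T = 0. *)
Lemma dilation_eigenvector (R : realType) m n (M : 'M[R]_(m, n)) i :
  exists2 w : 'rV[R]_(m + n), w != 0 &
    w *m block_mx 0 M M^T 0 = sigma M i 0 *: w.
Proof.
have [_ _ sE] := sigmaP M; set s := sigma M i 0.
have /eigenvalueP[v vM v0] : eigenvalue (M^T *m M) (s ^+ 2).
  rewrite eigenvalue_root_char sE /root horner_prod (bigD1 i) //=.
  by rewrite hornerXsubC subrr mul0r.
exists (row_mx (s^-1 *: (v *m M^T)) v).
  by apply: contra v0 => /eqP; rewrite -row_mx0 => /eq_row_mx[_ ->].
rewrite mul_row_block !mulmx0 add0r addr0 scale_row_mx scalerA.
rewrite -scalemxAl -mulmxA vM scalerA.
have [s0|s0] := eqVneq s 0; last by rewrite mulfV // scale1r expr2 mulKf.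
rewrite s0 invr0 !mul0r !scale0r; congr row_mx.
apply/eqP; rewrite -dot_row_eq0 trmx_mul trmxK mulmxA -(mulmxA v) vM s0.
by rewrite expr0n scale0r mul0mx mxE.
Qed.

Theorem sigma_second_order (R : realType) m n (X H : 'M[R]_(m, n)) i (b : R) :
  exists C d : R, 0 < d /\ forall t : R, 0 < t <= d ->
    `|(sigma (X + t *: H) i 0 - sigma X i 0) / t - b| <= d ->
    `|(sigma (X + t *: H) i 0 - sigma X i 0) / t - b| <= C * t.
Proof.
have bs (M : 'M[R]_(m, n)) : (block_mx 0 M M^T 0)^T = block_mx 0 M M^T 0.
  by rewrite tr_block_mx !trmx0 trmxK.
have [C [d [d0 Cd]]] := eigenvalue_second_order (sigma X i 0) b (bs X) (bs H).
exists C, d; split => // t td.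
have [w w0 wE] := dilation_eigenvector (X + t *: H) i.
apply: (Cd _ _ w) => //; rewrite -wE; congr (_ *m _).
by rewrite scale_block_mx !scaler0 add_block_mx !addr0 linearD linearZ.
Qed.

(** * Algebraic functions of one real variable near 0+ *)

Lemma near_at_right0P (R : realType) (P : R -> Prop) :
  (\forall t \near 0^'+, P t) <->
  exists2 e : R, 0 < e & forall t, 0 < t < e -> P t.
Proof.
split=> [[e /= e0 eP]|[e e0 eP]].
  exists e => // t /andP[t0 te]; apply: eP => //=.
  by rewrite sub0r normrN gtr0_norm.
near=> t; apply: eP; apply/andP; split; near: t.
  exact: nbhs_right_gt.
exact: nbhs_right_lt.
Unshelve. all: by end_near.
Qed.

Lemma poly_near_neq0 (R : realType) (p : {poly R}) : p != 0 ->
  \forall t \near (0 : R)^'+, p.[t] != 0.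
Proof.
move=> p0; have [k [q]] := multiplicity_XsubC p 0; rewrite p0 /= => q0 ->.
have q00 : q.[0] != 0 by [].
near=> t; rewrite hornerM horner_exp hornerXsubC subr0 mulf_neq0 //.
  near: t; apply: (@cvgr_neq0 _ _ _ _ _ (horner q) q.[0]) => //.
  by apply: cvg_at_right_filter; exact: continuous_horner.
apply: expf_neq0; apply: lt0r_neq0; near: t; exact: nbhs_right_gt.
Unshelve. all: by end_near.
Qed.

Lemma continuous_nonvanishing_sign (R : realType) (g : R -> R) e :
  continuous g -> (forall t, 0 < t < e -> g t != 0) ->
  (forall t, 0 < t < e -> 0 < g t) \/ (forall t, 0 < t < e -> g t < 0).
Proof.
move=> gc g0.
have [e0|e0] := leP e 0.
  by left => t /andP[t0 te]; have := lt_trans t0 te; rewrite ltNge e0.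
have same s t : s <= t -> 0 < s < e -> 0 < t < e -> (0 < g s) = (0 < g t).
  move=> st /andP[s0 se] /andP[t0 te]; apply: contrapT => /eqP gst.
  have [||c /=] := @IVT R g s t 0 st.
  - by apply: continuous_subspaceT => x; exact: gc.
  - have := g0 s; have := g0 t; rewrite s0 se t0 te => /(_ isT) gt /(_ isT) gs.
    move: gst; rewrite ge_min le_max.
    by case: (ltgtP 0 (g s)) gs; case: (ltgtP 0 (g t)) gt => //=.
  - rewrite in_itv /= => /andP[sc ct] /eqP; apply/negP/g0.
    by rewrite (lt_le_trans s0) // (le_lt_trans ct).
have e2 : 0 < e / 2 < e by rewrite divr_gt0 //= ltr_pdivrMr // ltr_pMr // ltr1n.
have all t : 0 < t < e -> (0 < g t) = (0 < g (e / 2)).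
  by move=> te; have [h|/ltW h] := leP t (e / 2); [|apply/esym]; exact: same.
have [gp|gn] := boolP (0 < g (e / 2)); [left|right] => t te.
  by rewrite all.
by rewrite lt_def eq_sym g0 //= leNgt all.
Qed.

Lemma continuous_bivariate_horner (R : realType) (h : R -> R)
    (P : {poly {poly R}}) : continuous h ->
  continuous (fun t : R => (map_poly (horner_eval t) P).[h t]).
Proof.
move=> hc; elim/poly_ind: P => [|P c IH].
  have -> : (fun t : R =>
      (map_poly (horner_eval t) (0 : {poly {poly R}})).[h t]) = (fun=> 0).
    by apply/funext => t; rewrite rmorph0 horner0.
  by move=> t; exact: cvg_cst.
have -> : (fun t : R => (map_poly (horner_eval t) (P * 'X + c%:P)).[h t]) =
    (fun t : R => (map_poly (horner_eval t) P).[h t] * h t + c.[t]).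
  apply/funext => t.
  by rewrite rmorphD rmorphM /= map_polyX map_polyC hornerMXaddC.
move=> t; apply: cvgD; last exact: continuous_horner.
by apply: cvgM; [exact: IH|exact: hc].
Qed.

(** Write P = Q Y^k with Q(t, 0) a nonzero polynomial, hence nonvanishing on
    some interval ]0, e[.  There h and phi(t) = Q(t, h(t)) satisfy h phi = 0
    and have no common zero, so the continuous function |h| - |phi| does not
    vanish: either h is identically 0 on ]0, e[ or it never vanishes there. *)
Theorem algebraic_function_sign (R : realType) (h : R -> R)
    (P : {poly {poly R}}) : continuous h -> P != 0 ->
  (forall t, root (map_poly (horner_eval t) P) (h t)) ->
  (\forall t \near 0^'+, 0 <= h t) \/ (\forall t \near 0^'+, h t <= 0).
Proof.
move=> hc P0 Ph.
have [k [Q]] := multiplicity_XsubC P 0; rewrite P0 /= => Q0 PE.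
have /poly_near_neq0/near_at_right0P[e e0 eQ] : Q.[0] != 0 by [].
pose phi t := (map_poly (horner_eval t) Q).[h t].
have phic : continuous phi by exact: continuous_bivariate_horner.
have prod0 t : h t != 0 -> phi t = 0.
  move=> ht; have := Ph t; rewrite PE /root subr0.
  rewrite rmorphM rmorphXn /= map_polyX hornerM horner_exp hornerX mulf_eq0.
  by rewrite expf_eq0 (negbTE ht) andbF orbF => /eqP.
have phi0 t : 0 < t < e -> h t = 0 -> phi t != 0.
  move=> te ht; rewrite /phi ht.
  have -> : (map_poly (horner_eval t) Q).[0] = Q.[0].[t].
    by rewrite -{1}(rmorph0 (horner_eval t)) horner_map.
  exact: eQ.
have psic : continuous (fun t => `|h t| - `|phi t|).
  move=> t; apply: cvgB; apply: cvg_norm; [exact: hc|exact: phic].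
have [|hn0|h0] := @continuous_nonvanishing_sign R _ e psic.
- move=> t te; have [ht|ht] := eqVneq (h t) 0.
    by rewrite ht normr0 sub0r oppr_eq0 normr_eq0 phi0.
  by rewrite prod0 // normr0 subr0 normr_eq0.
- have [|hp|hn] := @continuous_nonvanishing_sign R h e hc.
  + move=> t te; apply: contraTneq (hn0 t te) => ->.
    by rewrite normr0 sub0r oppr_gt0 ltNge normr_ge0.
  + by left; apply/near_at_right0P; exists e => // t te; exact/ltW/hp.
  + by right; apply/near_at_right0P; exists e => // t te; exact/ltW/hn.
- left; apply/near_at_right0P; exists e => // t te.
  have [->//|ht] := eqVneq (h t) 0.
  by have := h0 t te; rewrite prod0 // normr0 subr0 ltNge normr_ge0.
Qed.

(** The limit is the supremum of the constants that are eventually lower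
    bounds. *)
Lemma cvg_at_right_dichotomy (R : realType) (q : R -> R) C :
  (\forall t \near 0^'+, `|q t| <= C) ->
  (forall c, (\forall t \near 0^'+, c <= q t) \/
             (\forall t \near 0^'+, q t <= c)) ->
  cvg (q @ 0^'+).
Proof.
move=> qC qd; pose A := [set c | \forall t \near 0^'+, c <= q t].
have AC : ubound A C.
  move=> c Ac; near (0 : R)^'+ => t.
  apply: (@le_trans _ _ (q t)); first by near: t.
  by apply: (le_trans (ler_norm _)); near: t.
have AN : A (- C).
  apply: filterS qC => t; rewrite ler_norml => /andP[] //.
have As : has_sup A by split; [exists (- C)|exists C].
apply/cvg_ex; exists (sup A); apply/cvgrPdist_le => e e0.
have [c Ac cA] := sup_adherent e0 As.
have up : \forall t \near 0^'+, q t <= sup A + e.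
  case: (qd (sup A + e)) => // Ae.
  by have := sup_upper_bound As Ae; rewrite leNgt ltrDl e0.
near=> t.
have qu : q t <= sup A + e by near: t.
have ql : c <= q t by near: t.
by rewrite ler_norml; apply/andP; split; lra.
Unshelve. all: by end_near.
Qed.

(** * First and second directional derivatives of the singular values *)

Lemma cvg_colvec (R : realType) n (T : Type) (F : set_system T) (FF : Filter F)
    (f : T -> 'cV[R]_n) (b : 'cV[R]_n) :
  (forall i, f x i 0 @[x --> F] --> b i 0) -> f x @[x --> F] --> b.
Proof.
move=> fb; apply/cvgrPdist_le => e e0.
have : \forall x \near F, forall i, `|b i 0 - f x i 0| <= e.
  by apply: filter_forall => i; have /cvgrPdist_le/(_ _ e0) := fb i.
apply: filterS => x xe; apply: mx_norm_le => [|i j]; first exact: ltW.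
by rewrite ord1 !mxE.
Qed.

Lemma cvg_mx_entry (R : realType) m n (T : Type) (F : set_system T)
    (FF : Filter F) (f : T -> 'M[R]_(m, n)) (b : 'M[R]_(m, n)) i j :
  f x @[x --> F] --> b -> f x i j @[x --> F] --> b i j.
Proof.
move=> /cvgrPdist_le fb; apply/cvgrPdist_le => e /fb; apply: filterS => x.
by have := ler_mx_norm_entry (b - f x) i j; rewrite !mxE; exact: le_trans.
Qed.

Lemma continuous_sigma_entry (R : realType) m n i :
  continuous (fun M : 'M[R]_(m, n) => sigma M i 0).
Proof.
move=> M; apply/(@cvgrPdist_le _ _ _ (nbhs M) (nbhs_filter M)) => e e0.
pose K : R := (m * n)%:R + 1; have K0 : 0 < K by rewrite ltr_wpDl.
have : \forall N \near M, `|M - N| <= e / K.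
  have /(@cvgrPdist_le _ _ _ (nbhs M) (nbhs_filter M))/(_ (e / K)) :
    id N @[N --> M] --> M by exact: cvg_id.
  by apply; rewrite divr_gt0.
apply: filterS => N MN; have := ler_mx_norm_entry (sigma M - sigma N) i 0.
rewrite !mxE => /le_trans; apply; apply: le_trans (sigma_lipschitz M N) _.
apply: (@le_trans _ _ (K * `|M - N|)); first by rewrite ler_wpM2r // lerDl.
by rewrite mulrC -ler_pdivlMr.
Qed.

(** The square of h + p is a root of the characteristic polynomial of
    M(t)^T M(t), whose coefficients are polynomials in t; composing with
    (Y + p(t))^2 gives a bivariate polynomial that vanishes at (t, h(t)). *)
Lemma sigma_curve_sign (R : realType) m n (X H W : 'M[R]_(m, n)) i
    (p : {poly R}) :
  let h t := sigma (X + t *: H + (2^-1 * t ^+ 2) *: W) i 0 - p.[t] in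
  (\forall t \near 0^'+, 0 <= h t) \/ (\forall t \near 0^'+, h t <= 0).
Proof.
move=> h; pose M t := X + t *: H + (2^-1 * t ^+ 2) *: W.
have Mc : continuous M.
  move=> t; apply: cvgD; first apply: cvgD; first exact: cvg_cst.
    by apply: cvgZr_tmp; exact: cvg_id.
  apply: cvgZr_tmp; apply: cvgMr; exact: exprn_continuous.
have hc : continuous h.
  move=> t; apply: cvgB; last exact: continuous_horner.
  exact: (continuous_comp (Mc t) (@continuous_sigma_entry R m n i (M t))).
pose MM : 'M[{poly R}]_(m, n) := map_mx polyC X + 'X *: map_mx polyC H +
  (2^-1 *: 'X^2) *: map_mx polyC W.
have MME t : map_mx (horner_eval t) MM = M t.
  by apply/matrixP => a b; rewrite !mxE /horner_eval !hornerE.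
pose q : {poly {poly R}} := 'X + (p%:P).
apply: (@algebraic_function_sign _ _ (char_poly (MM^T *m MM) \Po (q ^+ 2)) hc).
  rewrite comp_poly_eq0; last first.
    by have := size_exp q 2; rewrite size_XaddC; case: (size _) => [|[]].
  exact/monic_neq0/char_poly_monic.
move=> t; rewrite map_comp_poly /root horner_comp map_char_poly.
rewrite map_mxM -map_trmx MME rmorphXn rmorphD /= map_polyX map_polyC hornerE.
have [_ _ ->] := sigmaP (M t).
rewrite horner_prod (bigD1 i) //= !hornerE /horner_eval.
by rewrite subrK subrr mul0r.
Qed.

Lemma sigma_d1_cvg (R : realType) m n (X H : 'M[R]_(m, n)) :
  t^-1 *: (sigma (X + t *: H) - sigma X) @[t --> 0^'+] --> sigma_d1 X H.
Proof.
suff : cvg (t^-1 *: (sigma (X + t *: H) - sigma X) @[t --> (0 : R)^'+]) by [].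
suff E i : cvg (t^-1 * (sigma (X + t *: H) i 0 - sigma X i 0)
    @[t --> (0 : R)^'+]).
  apply/cvg_ex; exists (\col_i lim (t^-1 *
     (sigma (X + t *: H) i 0 - sigma X i 0) @[t --> (0 : R)^'+])).
  apply: cvg_colvec => i; rewrite mxE.
  under eq_fun do rewrite !mxE.
  exact: E.
apply: (@cvg_at_right_dichotomy _ _ ((m * n)%:R * `|H|)).
  near=> t; have t0 : 0 < t by near: t; exact: nbhs_right_gt.
  rewrite normrM gtr0_norm ?invr_gt0 // mulrC ler_pdivrMr //.
  have := ler_mx_norm_entry (sigma (X + t *: H) - sigma X) i 0.
  rewrite !mxE => /le_trans; apply; apply: le_trans (sigma_lipschitz _ _) _.
  by rewrite addrC addKr normrZ gtr0_norm // mulrCA mulrC.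
move=> c; have := sigma_curve_sign X H 0 i ((sigma X i 0)%:P + c *: 'X).
have E t : (2^-1 * t ^+ 2) *: (0 : 'M[R]_(m, n)) = 0 by rewrite scaler0.
case=> h; [left|right]; near=> t.
- have t0 : 0 < t by near: t; exact: nbhs_right_gt.
  have : 0 <= sigma (X + t *: H + (2^-1 * t ^+ 2) *: (0 : 'M[R]_(m, n))) i 0
     - ((sigma X i 0)%:P + c *: 'X).[t] by near: t.
  rewrite E addr0 !hornerE [in X in _ -> X]mulrC [in X in _ -> X]ler_pdivlMr //.
  by move: (sigma (X + t *: H) i 0) (sigma X i 0) => a b; lra.
- have t0 : 0 < t by near: t; exact: nbhs_right_gt.
  have : sigma (X + t *: H + (2^-1 * t ^+ 2) *: (0 : 'M[R]_(m, n))) i 0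
     - ((sigma X i 0)%:P + c *: 'X).[t] <= 0 by near: t.
  rewrite E addr0 !hornerE [in X in _ -> X]mulrC [in X in _ -> X]ler_pdivrMr //.
  by move: (sigma (X + t *: H) i 0) (sigma X i 0) => a b; lra.
Unshelve. all: by end_near.
Qed.

(** The second-order quotient is bounded because the term in W contributes
    O(t^2) by Lipschitz continuity and sigma_second_order, applied with
    b = sigma'(X; H), controls the rest. *)
Lemma sigma_d2_cvg (R : realType) m n (X H W : 'M[R]_(m, n)) :
  (2^-1 * t ^+ 2)^-1 *: (sigma (X + t *: H + (2^-1 * t ^+ 2) *: W) - sigma X
     - t *: sigma_d1 X H) @[t --> 0^'+] --> sigma_d2 X H W.
Proof.
set d := sigma_d1 X H.
pose M (t : R) := X + t *: H + (2^-1 * t ^+ 2) *: W.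
suff : cvg ((2^-1 * t ^+ 2)^-1 *: (sigma (M t) - sigma X - t *: d)
   @[t --> (0 : R)^'+]) by [].
suff E i : cvg ((2^-1 * t ^+ 2)^-1 * (sigma (M t) i 0 - sigma X i 0 - t * d i 0)
    @[t --> (0 : R)^'+]).
  apply/cvg_ex; exists (\col_i lim ((2^-1 * t ^+ 2)^-1 *
     (sigma (M t) i 0 - sigma X i 0 - t * d i 0) @[t --> (0 : R)^'+])).
  apply: cvg_colvec => i; rewrite mxE.
  under eq_fun do rewrite !mxE.
  exact: E.
have [C [e [e0 Ce]]] := sigma_second_order X H i (d i 0).
have d1 : t^-1 * (sigma (X + t *: H) i 0 - sigma X i 0) @[t --> 0^'+] --> d i 0.
  have -> : (fun t => t^-1 * (sigma (X + t *: H) i 0 - sigma X i 0)) =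
      (fun t => (t^-1 *: (sigma (X + t *: H) - sigma X)) i 0).
    by apply/funext => t; rewrite !mxE.
  exact: @cvg_mx_entry _ _ _ _ _ _ _ _ i 0 (@sigma_d1_cvg R m n X H).
apply: (@cvg_at_right_dichotomy _ _ ((m * n)%:R * `|W| + 2 * C)).
  near=> t; have t0 : 0 < t by near: t; exact: nbhs_right_gt.
  have t2 : 0 < 2^-1 * t ^+ 2 by rewrite mulr_gt0 // exprn_gt0.
  rewrite normrM gtr0_norm ?invr_gt0 // mulrC ler_pdivrMr //.
  have h1 : `|sigma (M t) i 0 - sigma (X + t *: H) i 0| <=
      (m * n)%:R * `|W| * (2^-1 * t ^+ 2).
    have := ler_mx_norm_entry (sigma (M t) - sigma (X + t *: H)) i 0.
    rewrite !mxE => /le_trans; apply; apply: le_trans (sigma_lipschitz _ _) _.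
    by rewrite /M addrC addKr normrZ gtr0_norm // mulrCA mulrC.
  have h2 : `|(sigma (X + t *: H) i 0 - sigma X i 0) / t - d i 0| <= C * t.
    apply: Ce; first by rewrite t0 /=; near: t; exact: nbhs_right_le.
    rewrite distrC mulrC; near: t.
    by have /cvgrPdist_le := d1; apply.
  have h3 : `|sigma (X + t *: H) i 0 - sigma X i 0 - t * d i 0| <= C * t * t.
    have -> : sigma (X + t *: H) i 0 - sigma X i 0 - t * d i 0 =
        ((sigma (X + t *: H) i 0 - sigma X i 0) / t - d i 0) * t.
      by rewrite mulrBl divfK ?gt_eqF // (mulrC t).
    by rewrite normrM (gtr0_norm t0) ler_pM2r.
  have split3 (p q r u : R) : p - q - u = (p - r) + (r - q - u) by ring.
  rewrite (split3 _ _ (sigma (X + t *: H) i 0)).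
  apply: le_trans (ler_normD _ _) _; lra.
move=> c; have := sigma_curve_sign X H W i
  ((sigma X i 0)%:P + d i 0 *: 'X + (2^-1 * c) *: 'X^2).
case=> h; [left|right]; near=> t.
- have t0 : 0 < t by near: t; exact: nbhs_right_gt.
  have t2 : 0 < 2^-1 * t ^+ 2 by rewrite mulr_gt0 // exprn_gt0.
  have : 0 <= sigma (M t) i 0
     - ((sigma X i 0)%:P + d i 0 *: 'X + (2^-1 * c) *: 'X^2).[t] by near: t.
  rewrite !(hornerD, hornerZ, hornerC, hornerX, hornerXn) .
  rewrite [in X in _ -> X]mulrC [in X in _ -> X]ler_pdivlMr //.
  by move: (sigma (M t) i 0) (sigma X i 0) => a b; lra.
- have t0 : 0 < t by near: t; exact: nbhs_right_gt.
  have t2 : 0 < 2^-1 * t ^+ 2 by rewrite mulr_gt0 // exprn_gt0.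
  have : sigma (M t) i 0
     - ((sigma X i 0)%:P + d i 0 *: 'X + (2^-1 * c) *: 'X^2).[t] <= 0
    by near: t.
  rewrite !(hornerD, hornerZ, hornerC, hornerX, hornerXn) .
  rewrite [in X in _ -> X]mulrC [in X in _ -> X]ler_pdivrMr //.
  by move: (sigma (M t) i 0) (sigma X i 0) => a b; lra.
Unshelve. all: by end_near.
Qed.

(** * Transferring lower limits through the singular value map *)

(** Comparison of two lower limits when every value of [a2] close to the limit
    point is also a value of [a1] at some point close to its own. *)
Lemma limf_einf_le (R : realType) (T1 T2 : choiceType) (X1 : filteredType T1)
    (X2 : filteredType T2) (F1 : set_system X1) (F2 : set_system X2)
    (a1 : X1 -> \bar R) (a2 : X2 -> \bar R) :
  (forall A, F1 A -> F2 [set y | exists2 x, A x & a1 x = a2 y]) ->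
  (limf_einf a1 F1 <= limf_einf a2 F2)%E.
Proof.
move=> F12; rewrite !limf_einfE; apply: ub_ereal_sup => _ [A FA <-].
apply: le_trans (ereal_sup_ubound _); last first.
  by exists [set y | exists2 x, A x & a1 x = a2 y]; first exact: F12.
apply: le_ereal_inf_tmp => _ [y [x Ax a12] <-].
by apply: ereal_inf_lbound; exists x.
Qed.

Lemma cvg_at_right0 (R : realType) (tau : nat -> R) :
  (forall k, 0 < tau k) -> tau @ \oo --> 0 -> tau k @[k --> \oo] --> 0^'+.
Proof.
move=> tau0 tau_cvg A [e /= e0 eA]; have /cvgrPdist_lt/(_ _ e0) := tau_cvg.
by apply: filterS => k ke; apply: eA => //=; rewrite tau0.
Qed.

Section SpectralTransfer.
Variables (R : realType) (m n : nat) (le_nm : (n <= m)%N).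
Variables (Y : R -> 'M[R]_(m, n)) (y : R -> 'cV[R]_n) (c : R -> R).
Hypothesis c_gt0 : forall t, 0 < t -> 0 < c t.

(** The direction in R^n that follows the curve [y] at scale [c] to the singular
    values reached from [Y] in the direction [W]; see sigma_quotientK. *)
Definition sigma_quotient (t : R) (W : 'M[R]_(m, n)) : 'cV[R]_n :=
  (c t)^-1 *: (sigma (Y t + c t *: W) - y t).

Lemma sigma_quotientK t W : 0 < t ->
  y t + c t *: sigma_quotient t W = sigma (Y t + c t *: W).
Proof.
move=> t0; rewrite scalerA mulfV ?gt_eqF ?c_gt0 // scale1r addrC.
by rewrite subrK.
Qed.

Lemma sigma_quotient_lipschitz t (W W' : 'M[R]_(m, n)) : 0 < t ->
  `|sigma_quotient t W - sigma_quotient t W'| <= (m * n)%:R * `|W - W'|.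
Proof.
move=> /c_gt0 c0; rewrite /sigma_quotient -scalerBr.
have subBB (p q r : 'cV[R]_n) : (p - r) - (q - r) = p - q.
  by rewrite opprB addrA subrK.
rewrite subBB normrZ gtr0_norm ?invr_gt0 // mulrC ler_pdivrMr //.
apply: le_trans (sigma_lipschitz _ _) _.
have -> : Y t + c t *: W - (Y t + c t *: W') = c t *: (W - W').
  by rewrite scalerBr opprD addrACA subrr add0r.
by rewrite normrZ gtr0_norm // -mulrA (mulrC (c t)).
Qed.

Lemma lift_direction t W z : 0 < t ->
  exists2 W' : 'M[R]_(m, n), `|W' - W| <= n%:R * `|z - sigma_quotient t W| &
    forall f, absolutely_symmetric f ->
      f (sigma (Y t + c t *: W')) = f (y t + c t *: z).
Proof.
move=> t0; have c0 := c_gt0 t0.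
have [Z ZM Zf] :=
  exists_matrix_over_vector (Y t + c t *: W) (y t + c t *: z) le_nm.
exists ((c t)^-1 *: (Z - Y t)); last first.
  have ZE : Y t + c t *: ((c t)^-1 *: (Z - Y t)) = Z.
    by rewrite scalerA mulfV ?gt_eqF // scale1r addrC subrK.
  by move=> f /Zf <-; rewrite ZE.
have -> : (c t)^-1 *: (Z - Y t) - W = (c t)^-1 *: (Z - (Y t + c t *: W)).
  by rewrite opprD addrA [RHS]scalerBr scalerA mulVf ?gt_eqF // scale1r.
rewrite normrZ gtr0_norm ?invr_gt0 // mulrC ler_pdivrMr //.
apply: le_trans ZM _; rewrite -(sigma_quotientK W t0) opprD addrACA subrr add0r.
by rewrite -scalerBr normrZ gtr0_norm // -mulrA (mulrC (c t)).
Qed.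

Variables (W : 'M[R]_(m, n)) (z : 'cV[R]_n).
Hypothesis quotient_cvg : sigma_quotient t W @[t --> 0^'+] --> z.

(** Along the curves [Y] and [y] and at the scale [c], directions [W'] near [W]
    and directions [z'] near [z] produce the same values of [f]: from [W'] to
    [z'] by taking the quotient of [sigma], from [z'] to [W'] by
    lift_direction.  [Phi] stands for the rest of a difference quotient, so
    that one statement serves the first and the second order. *)
Lemma limf_einf_sigma (f : 'cV[R]_n -> \bar R) (Phi : R -> \bar R -> \bar R) :
  absolutely_symmetric f ->
  limf_einf (fun tW : R * 'M[R]_(m, n) =>
      Phi tW.1 (f (sigma (Y tW.1 + c tW.1 *: tW.2))))
    (filter_prod 0^'+ (nbhs W)) =
  limf_einf (fun tz : R * 'cV[R]_n => Phi tz.1 (f (y tz.1 + c tz.1 *: tz.2)))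
    (filter_prod 0^'+ (nbhs z)).
Proof.
move=> fsym; apply/eqP; rewrite eq_le; apply/andP; split;
  apply: limf_einf_le => A [[A1 A2] /= [FA1 FA2] A12].
- have /nbhs_ballP[e /= e0 eA2] := FA2.
  pose K : R := n%:R + 1; have K0 : 0 < K by rewrite ltr_wpDl.
  pose d := e / (K + K); have d0 : 0 < d by rewrite divr_gt0 // addr_gt0.
  exists ([set t | [/\ A1 t, 0 < t & `|z - sigma_quotient t W| < d]],
          ball z d) => /=.
    split; last exact: nbhsx_ballx.
    have /cvgrPdist_lt/(_ _ d0) qd := quotient_cvg.
    by near=> t; split; near: t => //; exact: nbhs_right_gt.
  move=> [t z'] [/= [A1t t0 zq]]; rewrite mx_norm_ball /ball_ /= => zz'.
  have [W' W'W fW'] := lift_direction W z' t0.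
  exists (t, W') => /=; last by rewrite fW'.
  apply: A12; split=> //=; apply: eA2; rewrite mx_norm_ball /ball_ /= distrC.
  apply: le_lt_trans W'W _.
  have h : `|z' - sigma_quotient t W| < d + d.
    apply: le_lt_trans (ler_distD z _ _) _.
    by apply: ltrD; [rewrite distrC; exact: zz'|exact: zq].
  apply: (@le_lt_trans _ _ (n%:R * (d + d))); first by rewrite ler_wpM2l // ltW.
  have -> : e = K * (d + d).
    by rewrite /d; field; apply: lt0r_neq0; rewrite addr_gt0.
  by rewrite ltr_pM2r ?addr_gt0 // ltrDl.
- have /nbhs_ballP[e /= e0 eA2] := FA2.
  pose K : R := (m * n)%:R + 1; have K0 : 0 < K by rewrite ltr_wpDl.
  have e2 : 0 < e / 2 by rewrite divr_gt0.
  exists ([set t | [/\ A1 t, 0 < t & `|z - sigma_quotient t W| < e / 2]],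
          ball W (e / 2 / K)) => /=.
    split; last by apply: nbhsx_ballx; rewrite divr_gt0.
    have /cvgrPdist_lt/(_ _ e2) qd := quotient_cvg.
    by near=> t; split; near: t => //; exact: nbhs_right_gt.
  move=> [t W'] [/= [A1t t0 zq]]; rewrite mx_norm_ball /ball_ /= => WW'.
  exists (t, sigma_quotient t W') => /=; last by rewrite sigma_quotientK.
  apply: A12; split=> //=; apply: eA2; rewrite mx_norm_ball /ball_ /=.
  apply: le_lt_trans (ler_distD (sigma_quotient t W) _ _) _.
  rewrite (splitr e); apply: ltrD; first exact: zq.
  apply: le_lt_trans (sigma_quotient_lipschitz _ _ t0) _.
  apply: (@le_lt_trans _ _ (K * `|W - W'|)).
    by rewrite ler_wpM2r // lerDl.
  by rewrite mulrC -ltr_pdivlMr.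
Unshelve. all: by end_near.
Qed.

Lemma sigma_quotient_cvg_seq (tau : nat -> R) :
  (forall k, 0 < tau k) -> tau @ \oo --> 0 ->
  sigma_quotient (tau k) W @[k --> \oo] --> z.
Proof.
move=> tau0 tau_cvg.
exact: cvg_comp (cvg_at_right0 tau0 tau_cvg) quotient_cvg.
Qed.

End SpectralTransfer.

(** * Second subderivatives of spectral functions *)

Lemma bounded_sequence_cluster (R : realType) m n (Ws : nat -> 'M[R]_(m, n))
    (B : R) : (\forall k \near \oo, `|Ws k| <= B) ->
  exists W, cluster (Ws @ \oo) W.
Proof.
move=> WB; pose K := [set v : 'rV[R]_(m * n) | `|v| <= B].
have Kcompact : compact K.
  apply: bounded_closed_compact.
    exists B; split=> [|x Bx v /= /le_trans]; first exact: num_real.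
    by apply; exact: ltW.
  rewrite (_ : K = (fun v : 'rV[R]_(m * n) => `|v|) @^-1` [set x | x <= B]) //.
  by apply: closed_comp; [move=> v _; exact: norm_continuous|exact: closed_le].
have vec_norm (A : 'M[R]_(m, n)) : `|mxvec A| <= `|A|.
  apply: mx_norm_le => // i j; rewrite ord1; case/mxvec_indexP: j => a b.
  by rewrite mxvecE ler_mx_norm_entry.
have mx_of_vec_norm (v : 'rV[R]_(m * n)) : `|vec_mx v| <= `|v|.
  by apply: mx_norm_le => // i j; rewrite mxE ler_mx_norm_entry.
have [|v [_ vcl]] := Kcompact ((mxvec \o Ws) @ \oo) _.
  have : \forall k \near \oo, K (mxvec (Ws k)); last by [].
  by move: WB; apply: filterS => k; exact: le_trans (vec_norm _).
exists (vec_mx v) => A U WA /nbhs_ballP[e /= e0 eU].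
have : [set mxvec M | M in A] `&` ball v e !=set0.
  apply: (vcl [set mxvec M | M in A] (ball v e)); last exact: nbhsx_ballx.
  have : \forall k \near \oo, [set mxvec M | M in A] (mxvec (Ws k)); last by [].
  have : \forall k \near \oo, A (Ws k) by exact: WA.
  by apply: filterS => k Ak; exists (Ws k).
case=> w [[M AM <-]]; rewrite mx_norm_ball /ball_ /= => vM.
exists M; split=> //; apply: eU; rewrite mx_norm_ball /ball_ /=.
apply: le_lt_trans vM; rewrite -[M]mxvecK -linearB mxvecK.
exact: mx_of_vec_norm.
Qed.

Lemma limf_einf_frequently_le (R : realType) (T : choiceType)
    (X : filteredType T) (F : set_system X) (a : X -> \bar R) (b : \bar R) :
  (forall A, F A -> exists2 x, A x & (a x <= b)%E) -> (limf_einf a F <= b)%E.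
Proof.
move=> Fb; rewrite limf_einfE; apply: ub_ereal_sup => _ [A /Fb[x Ax xb] <-].
by apply: le_trans xb; apply: ereal_inf_lbound; exists x.
Qed.

Section SpectralFunction.
Variables (R : realType) (m n : nat) (le_nm : (n <= m)%N).
Variables (f : 'cV[R]_n -> \bar R) (f_sym : absolutely_symmetric f).
Variables (X H : 'M[R]_(m, n)).

Lemma subderivative_sigma :
  subderivative (f \o sigma) X H = subderivative f (sigma X) (sigma_d1 X H).
Proof.
exact: (@limf_einf_sigma R m n le_nm (fun=> X) (fun=> sigma X) id
  (fun _ t0 => t0) H (sigma_d1 X H) (@sigma_d1_cvg R m n X H) f
  (fun t v => ((t^-1)%:E * (v - f (sigma X)))%E) f_sym).
Qed.

Let Y (t : R) := X + t *: H.
Let y (t : R) := sigma X + t *: sigma_d1 X H.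
Let c (t : R) := 2^-1 * t ^+ 2.

Let c_gt0 t : 0 < t -> 0 < c t.
Proof. by move=> t0; rewrite mulr_gt0 // exprn_gt0. Qed.

Let quotient_cvg W :
  sigma_quotient Y y c t W @[t --> 0^'+] --> sigma_d2 X H W.
Proof.
rewrite (_ : (fun t => _) = fun t => (2^-1 * t ^+ 2)^-1 *:
  (sigma (X + t *: H + (2^-1 * t ^+ 2) *: W) - sigma X - t *: sigma_d1 X H)).
  exact: sigma_d2_cvg.
by apply/funext => t; rewrite /sigma_quotient opprD addrA.
Qed.

Lemma parabolic_subderivative_sigma W :
  parabolic_subderivative (f \o sigma) X H W =
  parabolic_subderivative f (sigma X) (sigma_d1 X H) (sigma_d2 X H W).
Proof.
rewrite /parabolic_subderivative /parabolic_quotient subderivative_sigma.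
have := (@limf_einf_sigma R m n le_nm Y y c c_gt0 W _ (@quotient_cvg W) f
  (fun t v => (((c t)^-1)%:E * (v - f (sigma X) -
     t%:E * subderivative f (sigma X) (sigma_d1 X H)))%E) f_sym).
exact.
Qed.

Lemma lift_parabolic_sequence W (tau : nat -> R) (zs : nat -> 'cV[R]_n) :
  (forall k, 0 < tau k) ->
  exists2 Ws : nat -> 'M[R]_(m, n),
    forall k, `|Ws k - W| <= n%:R * `|zs k - sigma_quotient Y y c (tau k) W| &
    forall k, parabolic_quotient (f \o sigma) X H (tau k) (Ws k) =
      parabolic_quotient f (sigma X) (sigma_d1 X H) (tau k) (zs k).
Proof.
move=> tau0.
have /choice[Ws WsP] : forall k, exists W' : 'M[R]_(m, n),
    `|W' - W| <= n%:R * `|zs k - sigma_quotient Y y c (tau k) W| /\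
    f (sigma (Y (tau k) + c (tau k) *: W')) = f (y (tau k) + c (tau k) *: zs k).
  move=> k; have [W' W'W fW'] :=
    lift_direction le_nm Y y c_gt0 W (zs k) (tau0 k).
  by exists W'; split=> //; exact: fW'.
exists Ws => k; first by have [] := WsP k.
rewrite /parabolic_quotient subderivative_sigma /=.
by have [_ <-] := WsP k.
Qed.

Lemma parabolically_epi_differentiable_sigma :
  parabolically_epi_differentiable f (sigma X) (sigma_d1 X H) ->
  parabolically_epi_differentiable (f \o sigma) X H.
Proof.
move=> [fX fd [z0 z0dom] fseq]; split=> //.
- by rewrite subderivative_sigma.
- pose tau (k : nat) : R := k.+1%:R^-1.
  have tau0 k : 0 < tau k by rewrite invr_gt0.
  have tau_cvg : tau @ \oo --> 0 by exact: cvg_harmonic.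
  have [zs zs_cvg q_cvg] := fseq z0 tau tau0 tau_cvg.
  have [Ws WsB Wsq] := lift_parabolic_sequence 0 zs tau0.
  have s_cvg := sigma_quotient_cvg_seq (@quotient_cvg 0) tau0 tau_cvg.
  have dist_cvg : `|zs k - sigma_quotient Y y c (tau k) 0| @[k --> \oo] -->
      `|z0 - sigma_d2 X H 0|.
    by apply: cvg_norm; apply: cvgB.
  have [|W0 W0cl] := @bounded_sequence_cluster _ _ _ Ws
      (n%:R * (`|z0 - sigma_d2 X H 0| + 1)).
    have /cvgrPdist_le/(_ 1 ltr01) := dist_cvg; apply: filterS => k.
    rewrite ler_norml => /andP[+ _]; rewrite lerBrDr addrC lerBlDr => h.
    by rewrite -[Ws k]subr0; apply: le_trans (WsB k) _; rewrite ler_wpM2l.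
  exists W0; rewrite /edom /=.
  have [M [M_lt q_lt]] : exists M : \bar R, (M < +oo)%E /\
      \forall k \near \oo, (parabolic_quotient f (sigma X) (sigma_d1 X H)
        (tau k) (zs k) <= M)%E.
    have [M LM M_lt] : exists2 M : \bar R, (parabolic_subderivative f (sigma X)
        (sigma_d1 X H) z0 < M)%E & (M < +oo)%E.
      move: z0dom; rewrite /edom /=.
      case: (parabolic_subderivative _ _ _ _) => [r _|//|_].
        by exists (r + 1)%:E; rewrite ?ltry // lte_fin ltrDl.
      by exists 0%E; rewrite ?ltNy0 // ltry.
    exists M; split=> //.
    have : \forall k \near \oo, (parabolic_quotient f (sigma X) (sigma_d1 X H)
        (tau k) (zs k) < M)%E by exact: (q_cvg _ (open_ereal_lt' LM)).
    by apply: filterS => k /ltW.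
  apply: le_lt_trans M_lt; apply: limf_einf_frequently_le => A.
  case=> -[A1 A2] /= [FA1 FA2] A12.
  have tau_right : \forall k \near \oo, A1 (tau k).
    exact: (cvg_at_right0 tau0 tau_cvg FA1).
  pose good := [set Ws k | k in [set k | A1 (tau k) /\
    (parabolic_quotient f (sigma X) (sigma_d1 X H) (tau k) (zs k) <= M)%E]].
  have Fgood : \forall k \near \oo, good (Ws k).
    by apply: filterS2 tau_right q_lt => k A1k qk; exists k.
  have := W0cl good A2 Fgood FA2.
  case=> _ [[k [A1k qk] <-] A2k]; exists (tau k, Ws k); first exact: A12.
  by rewrite /= Wsq.
- move=> W tau tau0 tau_cvg.
  have [zs zs_cvg q_cvg] := fseq (sigma_d2 X H W) tau tau0 tau_cvg.
  have [Ws WsB Wsq] := lift_parabolic_sequence W zs tau0.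
  have s_cvg := sigma_quotient_cvg_seq (@quotient_cvg W) tau0 tau_cvg.
  have dist_cvg : n%:R * `|zs k - sigma_quotient Y y c (tau k) W| @[k --> \oo]
      --> (0 : R).
    rewrite -(mulr0 (n%:R)) -(@normr0 _ 'cV[R]_n) -(subrr (sigma_d2 X H W)).
    by apply: cvgMr; apply: cvg_norm; apply: cvgB.
  exists Ws.
    apply/cvgrPdist_le => e e0; have /cvgrPdist_le/(_ _ e0) := dist_cvg.
    apply: filterS => k; rewrite sub0r normrN ger0_norm ?mulr_ge0 // => h.
    by rewrite distrC; exact: le_trans (WsB k) h.
  rewrite parabolic_subderivative_sigma; under eq_fun do rewrite Wsq.
  exact: q_cvg.
Qed.

End SpectralFunction.

Theorem theorem5p3 (R : realType) (m n : nat) (le_nm : (n <= m)%N)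
    (f : 'cV[R]_n -> \bar R) (f_sym : absolutely_symmetric f)
    (X : 'M[R]_(m, n)) (fX_fin : (f \o sigma) X \is a fin_num)
    (H : 'M[R]_(m, n)) (H_tan : tangent_cone (edom (f \o sigma)) X H)
    (f_lip : locally_lipschitz_rel_dom f)
    (f_epi : parabolically_epi_differentiable f (sigma X) (sigma_d1 X H)) :
  (forall W : 'M[R]_(m, n),
     parabolic_subderivative (f \o sigma) X H W =
     parabolic_subderivative f (sigma X) (sigma_d1 X H) (sigma_d2 X H W)) /\
  parabolically_epi_differentiable (f \o sigma) X H.
Proof.
split=> [W|]; first exact: parabolic_subderivative_sigma.
exact: parabolically_epi_differentiable_sigma.
Qed.
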